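(* Let $1<p<\infty$, let $N\ge0$ be an integer, and let $c_0,\ldots,c_N$ be given complex numbers with $c_0\neq0$. Suppose that $F\in A^p$, that $F^{(j)}(0)=c_j$ for $0\le j\le N$, and that $$\|F\|_{A^p}=\inf\{\|g\|_{A^p}: g\in A^p,\ g(0)=c_0,\ldots,g^{(N)}(0)=c_N\}.$$ Let $a_0=c_0^{p/2}$ for some branch of $z^{p/2}$. Define $$f(z)=\sum_{j=0}^N\frac{\beta_j^{p/2}(a_0;c_0,\ldots,c_j)}{j!}z^j .$$ Suppose that $f^{1-(2/p)}\in A^{p_1}$ for some $p_1>1$. Also suppose that $f$ has no zeros in $\mathbb{D}$, so that $f^{2/p}$ may be defined to be analytic in $\mathbb{D}$ with $f^{2/p}(0)=c_0$. Then $$F=f^{2/p}.$$ The same result also holds if, in place of the assumption that $f$ has no zeros in $\mathbb{D}$, one assumes that $p$ is rational, $2/p=r/s$ in lowest form, and every zero of $f$ in $\mathbb{D}$ has order a multiple of $s$.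
   Context: $\mathbb{D}$ is the open unit disc in $\mathbb{C}$ and $\sigma$ is area measure normalized so that $\sigma(\mathbb{D})=1$. For $1<p<\infty$, $A^p$ is the Bergman space of analytic functions $f$ on $\mathbb{D}$ with $\|f\|_{A^p}=\left(\int_{\mathbb{D}}|f|^p\,d\sigma\right)^{1/p}<\infty$. Definition of $\beta_j^t$: let $t$ be a real number, let $c_0,\ldots,c_N\in\mathbb{C}$ with $c_0\ne0$, and let $a=c_0^t$ for some branch of $z^t$. Put $h(z)=\sum_{j=0}^N\frac{c_j}{j!}z^j$, so that $h^{(j)}(0)=c_j$ for $0\le j\le N$. In a sufficiently small neighborhood $U$ of the origin, $h(U)$ omits $0$ and is contained in a half plane whose boundary contains the origin, so $z^t$ can be defined analytically on $h(U)$ with $c_0^t=a$. Then $\beta_j^t(a;c_0,\ldots,c_j)$ is the $j$-th derivative at $0$ of $h(z)^t$; it depends only on $j,t,a,c_0,\ldots,c_j$. In the case where $2/p=r/s$ in lowest form and all zeros of $f$ in $\mathbb{D}$ have order a multiple of $s$, $f^{2/p}$ denotes the analytic branch on $\mathbb{D}$ of the $s$-th root of $f^r$ with value $c_0$ at $0$. In all cases $f^{1-(2/p)}$ denotes $f/f^{2/p}$. *)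

(* Defs.v *)
From HB Require Import structures.
From mathcomp Require Import all_boot all_order all_algebra.
From mathcomp Require Import complex.
From mathcomp Require Import all_classical all_reals all_analysis.

Set Implicit Arguments.
Unset Strict Implicit.
Unset Printing Implicit Defensive.

Import Order.TTheory GRing.Theory Num.Theory numFieldNormedType.Exports.

Local Open Scope classical_set_scope.
Local Open Scope ring_scope.
Local Open Scope complex_scope.

(* Packing R[i] as a numFieldType makes the topology and the normed module
   structure of a numFieldType over itself available; hence [derivable f z 1]
   is complex differentiability and [derive1n n f] is the n-th complex
   derivative. *)
Definition Cplx (R : realType) : numFieldType := R[i].

Section Definitions.
Context {R : realType}.
Local Notation C := (Cplx R).
Implicit Types (U : set C) (f g k : C -> C) (p t : R).

Definition of_real t : C := t%:C.
Definition of_pair (u : R * R) : C := u.1 +i* u.2.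
Definition modulus (z : C) : R := Normc.normc z.

Definition cexp (z : C) : C :=
  let: x +i* y := z in (expR x * cos y) +i* (expR x * sin y).

Definition unit_disc : set C := [set z | modulus z < 1].

Definition analytic_on U f : Prop := forall z, U z -> derivable f z 1.

(* [v] is a value of [z ^ t] (z != 0) for some branch: v = exp (t * log z). *)
Definition is_cpow t (z v : C) : Prop :=
  exists w, cexp w = z /\ v = cexp (of_real t * w).

(* [g] is an analytic branch of [k ^ t] on the open set [U], that is,
   g = exp (t * L) for an analytic logarithm L of k. *)
Definition is_cpow_branch U t k g : Prop :=
  exists L, analytic_on U L /\
    forall z, U z -> cexp (L z) = k z /\ g z = cexp (of_real t * L z).

(* The factor 1 / pi normalizes Lebesgue measure on C = R * R so that the unit
   disc has measure 1. *)
Definition bergman_norm p f : \bar R :=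
  (((pi^-1)%:E *
    \int[(@lebesgue_measure R \x @lebesgue_measure R)%E]_(u in
          of_pair @^-1` unit_disc)
      (modulus (f (of_pair u)) `^ p)%:E) `^ p^-1)%E.

(* Elements of A^p are represented by functions on C whose values outside the
   disc are irrelevant. *)
Definition bergman p f : Prop :=
  analytic_on unit_disc f /\ (bergman_norm p f < +oo)%E.

Definition taylor_poly N (c : 'I_N.+1 -> C) : {poly C} :=
  \sum_(j < N.+1) (c j / (j`!)%:R) *: 'X^j.

Definition has_jet N (c : 'I_N.+1 -> C) f : Prop :=
  forall j : 'I_N.+1, derive1n j f 0 = c j.

(* A branch of [h ^ t] near 0 with value [a] at 0, where h = taylor_poly c.
   When c_0 != 0 and [a] is a value of [c_0 ^ t], such a branch exists and its
   germ at 0 is unique. *)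
Definition local_power t (a : C) N (c : 'I_N.+1 -> C) : C -> C :=
  get [set g | g 0 = a /\ exists U, open_nbhs 0 U /\
                 is_cpow_branch U t (horner (taylor_poly c)) g].

Definition beta t (a : C) N (c : 'I_N.+1 -> C) (j : 'I_N.+1) : C :=
  derive1n j (local_power t a c) 0.

(* The analytic branch of [f ^ t] on the disc with value [v] at 0, for f
   without zeros in the disc. *)
Definition disc_power t (v : C) f : C -> C :=
  get [set g | g 0 = v /\ is_cpow_branch unit_disc t f g].

(* The analytic branch on the disc of the s-th root of [f ^+ r] with value [v]
   at 0. *)
Definition disc_root (r s : nat) (v : C) f : C -> C :=
  get [set g | [/\ g 0 = v, analytic_on unit_disc g &
                 forall z, unit_disc z -> g z ^+ s = f z ^+ r]].

(* f / g belongs to A^p. At the zeros of g the quotient is not read pointwise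
   (where x / 0 = 0) but through its analytic extension q. *)
Definition bergman_quotient p f g : Prop :=
  exists q, bergman p q /\
    forall z, unit_disc z -> g z != 0 -> q z = f z / g z.

End Definitions.

(* Main.v *)
Require Import Defs.
From HB Require Import structures.
From mathcomp Require Import all_boot all_order all_algebra.
From mathcomp Require Import complex.
From mathcomp Require Import all_classical all_reals all_analysis.
From mathcomp Require Import measurable_realfun ring lra.

Set Implicit Arguments.
Unset Strict Implicit.
Unset Printing Implicit Defensive.

Import Order.TTheory GRing.Theory Num.Theory numFieldNormedType.Exports.

Local Open Scope classical_set_scope.
Local Open Scope ring_scope.

(** The candidate is [G = f ^ (2 / p)], and the reason why it is extremal is that
    [|G| ^ p = |f| ^ 2] with [f] a polynomial of degree at most [N].

    First, [G] has the prescribed jet: up to [o(z ^ N)], [f] is the power [p / 2]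
    of [h], where [h] is the Taylor polynomial of the data, and raising to the
    power [2 / p] preserves agreement up to [o(z ^ N)] ([power_flat] for
    exponentials of logarithms, [root_flat] for [s]-th roots). Hence [G] competes
    in the extremal problem, and [W = F - G] is [o(z ^ N)] at 0.

    Let [q = f / G], which is [f ^ (1 - 2 / p)]. The function [conj f * q * W]
    integrates to 0 over the disc: on every circle centred at 0, [q * W] has only
    frequencies greater than [N], while [conj f] has frequencies between [-N] and
    0 ([circle_mean_conj_poly], [integral_circle_mean0]). Since
    [conj f * q * G = |f| ^ 2 = |G| ^ p], the integral of [Re (conj f * q * F)]
    is that of [|G| ^ p]. On the other hand [|conj f * q * F|] is
    [|G| ^ (p - 1) * |F|], which by Young's inequality is at most
    [|F| ^ p / p + (1 - 1 / p) |G| ^ p]. As the norm of [F] is at most the norm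
    of [G], the nonnegative difference of the two sides has integral at most 0, so
    it vanishes identically, and the equality case of Young's inequality gives
    [F = G] at every point ([young_modulus], [extremal_unique]).

    Complex function theory enters only through [circle_coef_eq0]: if [H] is
    analytic and [o(z ^ j)] at 0, its Fourier coefficient of index [j] vanishes
    on circles centred at 0. In logarithmic coordinates this is Goursat's theorem
    for rectangles, applied to a function of period [2 pi i]. Cauchy's formula for
    [H'] is the case [j = 1], and yields that [H'] is again analytic
    ([derivable_derive1]); Taylor's formula follows, and jets become classes of
    functions modulo [o(z ^ n)] ([has_jet_flat]).

    The passage from circles to the disc uses that area is invariant under
    rotations, which holds because a rotation is a product of shears
    ([rotation_preserving]). *)

(** * The complex plane as a normed field *)

Arguments modulus : simpl never.
Arguments cexp : simpl never.

Lemma le_of_eq (R : realDomainType) (x y : R) : x = y -> x <= y.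
Proof. by move->. Qed.

Section basics.
Context {R : realType}.
Local Notation C := (Cplx R).
Implicit Types (z w : C).

Lemma normE z : `|z| = (modulus z)%:C%C :> C.
Proof. by case: z => x y; rewrite /modulus /=; exact: normc_def. Qed.

Lemma modulus_ge0 z : 0 <= modulus z.
Proof. by case: z => x y; exact: sqrtr_ge0. Qed.

Lemma modulusD z w : modulus (z + w) <= modulus z + modulus w.
Proof. exact: le_normcD. Qed.

Lemma modulusM z w : modulus (z * w) = modulus z * modulus w.
Proof. exact: Normc.normcM. Qed.

Lemma modulusN z : modulus (- z) = modulus z.
Proof. exact: normcN. Qed.

Lemma modulusB z w : modulus (z - w) <= modulus z + modulus w.
Proof. by rewrite -(modulusN w); exact: modulusD. Qed.

Lemma modulus_eq0 z : (modulus z == 0) = (z == 0).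
Proof.
apply/eqP/eqP => [/Normc.eq0_normc //|->]; exact: Normc.normc0.
Qed.

Lemma modulusV z : modulus z^-1 = (modulus z)^-1.
Proof. exact: Normc.normcV. Qed.

Lemma modulus_gt0 z : (0 < modulus z) = (z != 0).
Proof. by rewrite lt_def modulus_ge0 andbT modulus_eq0. Qed.

Lemma modulus1 : modulus (1 : C) = 1. Proof. exact: Normc.normc1. Qed.
Lemma modulus0 : modulus (0 : C) = 0. Proof. exact: Normc.normc0. Qed.

Lemma modulusX z n : modulus (z ^+ n) = modulus z ^+ n.
Proof.
by elim: n => [|n IH]; rewrite ?expr0 ?modulus1 // !exprS modulusM IH.
Qed.

Lemma modulus_real (x : R) : modulus (of_real x) = `|x|.
Proof. by rewrite /modulus /of_real /= expr0n /= addr0 sqrtr_sqr. Qed.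

Lemma ge_Re z : `|complex.Re z| <= modulus z.
Proof.
case: z => x y /=; rewrite /modulus /= -sqrtr_sqr ler_sqrt ?addr_ge0 ?sqr_ge0 //.
by rewrite lerDl sqr_ge0.
Qed.

Lemma ge_Im z : `|complex.Im z| <= modulus z.
Proof.
case: z => x y /=; rewrite /modulus /= -sqrtr_sqr ler_sqrt ?addr_ge0 ?sqr_ge0 //.
by rewrite lerDr sqr_ge0.
Qed.

Lemma modulus_le z : modulus z <= `|complex.Re z| + `|complex.Im z|.
Proof.
case: z => x y /=; rewrite /modulus /=.
rewrite -[leRHS]ger0_norm ?addr_ge0 // -sqrtr_sqr ler_sqrt ?sqr_ge0 //.
rewrite sqrrD !real_normK ?num_real // lerD2r lerDl.
by rewrite mulrn_wge0 // mulr_ge0.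
Qed.

Lemma nbhsP (P : set C) z :
  nbhs z P <-> exists2 d : R, 0 < d & forall w, modulus (w - z) < d -> P w.
Proof.
split.
  move=> /nbhs_ballP [e /= e0 H].
  have [d ed] : exists d : R, e = d%:C%C.
    by exists (complex.Re e); move: e0; case: (e) => a b; rewrite ltcE /= => /andP[/eqP -> _].
  exists d; first by move: e0; rewrite ed ltcR.
  move=> w wd; apply: H; rewrite /ball /= /ball_ /= ed normE ltcR.
  by rewrite -modulusN opprB.
move=> [d d0 H]; apply/nbhs_ballP; exists d%:C%C => /=; first by rewrite ltcR.
move=> w; rewrite /ball /= normE ltcR => wd; apply: H.
by rewrite -modulusN opprB.
Qed.

Lemma continuous_epsP (f : C -> C) z :
  {for z, continuous f} <-> forall e : R, 0 < e -> exists2 d : R, 0 < d &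
    forall w, modulus (w - z) < d -> modulus (f w - f z) < e.
Proof.
split=> [cf e e0|H].
  by have /(cf _)/nbhsP : nbhs (f z) [set y | modulus (y - f z) < e] by apply/nbhsP; exists e.
move=> P /nbhsP[e e0 eP]; have [d d0 dP] := H e e0.
by apply/nbhsP; exists d => // w /dP /eP.
Qed.

Lemma continuous_C2RP (f : C -> R) z :
  {for z, continuous f} <-> forall e : R, 0 < e -> exists2 d : R, 0 < d &
    forall w, modulus (w - z) < d -> `|f w - f z| < e.
Proof.
split=> [cf e e0|H].
  have : nbhs (f z) [set y | `|y - f z| < e].
    by apply/nbhs_ballP; exists e => //= y; rewrite /ball /= distrC.
  by move=> /(cf _)/nbhsP.
move=> P /nbhs_ballP[e /= e0 eP]; have [d d0 dP] := H e e0.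
by apply/nbhsP; exists d => // w /dP; rewrite distrC => /eP.
Qed.

Lemma modulus_dist z w : `|modulus z - modulus w| <= modulus (z - w).
Proof.
have H (a b : C) : modulus a - modulus b <= modulus (a - b).
  by rewrite lerBlDr (le_trans _ (modulusD _ _)) // subrK.
rewrite ler_norml H andbT lerNl opprB; apply: le_trans (H _ _) _.
by rewrite -modulusN opprB.
Qed.

Lemma modulus_continuous : continuous (@modulus R : C -> R).
Proof.
move=> z; apply/continuous_C2RP => e e0; exists e => // w.
exact/le_lt_trans/modulus_dist.
Qed.

Lemma Re_continuous : continuous (@complex.Re R : C -> R).
Proof.
move=> z; apply/continuous_C2RP => e e0; exists e => // w.
apply/le_lt_trans; apply: le_trans (ge_Re _).
by case: w z => a b [].
Qed.

Lemma Im_continuous : continuous (@complex.Im R : C -> R).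
Proof.
move=> z; apply/continuous_C2RP => e e0; exists e => // w.
apply/le_lt_trans; apply: le_trans (ge_Im _).
by case: w z => a b [].
Qed.

Lemma Complex_cvg (T : Type) (F : set_system T) {FF : Filter F} (f g : T -> R) a b :
  f @ F --> a -> g @ F --> b -> (fun t => (f t +i* g t)%C : C) @ F --> ((a +i* b)%C : C).
Proof.
move=> fa gb P /nbhsP[e e0 eP].
have e20 : 0 < e / 2 by rewrite divr_gt0.
move/cvgrPdist_lt : fa => /(_ _ e20) fa.
move/cvgrPdist_lt : gb => /(_ _ e20) gb.
change (\forall t \near F, P ((f t +i* g t)%C)).
near=> t; apply: eP; apply: le_lt_trans (modulus_le _) _ => /=.
by rewrite (splitr e); apply: ltrD; rewrite distrC; near: t; [exact: fa|exact: gb].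
Unshelve. all: by end_near. Qed.

Lemma of_pair_continuous : continuous (@of_pair R : R * R -> C).
Proof. by move=> u; apply: Complex_cvg; [exact: cvg_fst|exact: cvg_snd]. Qed.

(** The norm of the field takes values in the field itself; this turns complex
    differentiability into an estimate between real numbers. *)
Lemma is_derive_epsP (f : C -> C) z (l : C) :
  is_derive z 1 f l <-> forall e : R, 0 < e -> exists2 d : R, 0 < d &
    forall w, modulus (w - z) < d ->
      modulus (f w - f z - l * (w - z)) <= e * modulus (w - z).
Proof.
have aux (e : R) w : w - z != 0 ->
  (modulus (f w - f z - l * (w - z)) <= e * modulus (w - z)) =
  (modulus (l - (w - z)^-1 * (f w - f z)) <= e).
  move=> wz; rewrite -ler_pdivrMr ?modulus_gt0 // -modulusV -modulusM.
  by rewrite -modulusN -mulNr opprB mulrBl mulfK // [_ / _]mulrC.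
split.
  move=> [df dl] e e0.
  have : (h^-1 *: ((f \o shift z) (h *: 1) - f z)) @[h --> (0:C)^'] --> l by rewrite -dl.
  move/cvgrPdist_le => /(_ e%:C%C); rewrite ltcR => /(_ e0).
  rewrite near_withinE => /nbhsP[d d0 dP]; exists d => // w wd.
  have [->|wz] := eqVneq w z; first by rewrite !subrr mulr0 subr0 modulus0 mulr0.
  have wz' : w - z != 0 by rewrite subr_eq0.
  rewrite (aux e w wz'); have := dP (w - z).
  rewrite subr0 => /(_ wd); rewrite subr_eq0 => /(_ wz) /=.
  by rewrite normE lecR /= /GRing.scale /= mulr1 subrK.
move=> H.
have cvg_l : (h^-1 *: ((f \o shift z) (h *: 1) - f z)) @[h --> (0:C)^'] --> l.
  apply/cvgrPdist_le => e' e'0.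
  have [e ee] : exists e : R, e' = e%:C%C.
    by exists (complex.Re e'); move: e'0; case: (e') => a b; rewrite ltcE /= => /andP[/eqP -> _].
  have e0 : 0 < e by move: e'0; rewrite ee ltcR.
  have [d d0 dP] := H e e0.
  rewrite near_withinE; apply/nbhsP; exists d => // h; rewrite subr0 => hd h0.
  rewrite ee normE lecR /= /GRing.scale /= mulr1.
  have := dP (h + z); rewrite addrK => /(_ hd).
  by have := aux e (h + z); rewrite addrK => ->.
by split; [apply/cvg_ex; exists l|exact: (cvg_lim (@norm_hausdorff _ _) cvg_l)].
Qed.

Lemma derivable_cont (f : C -> C) z : derivable f z 1 -> {for z, continuous f}.
Proof. by move=> /derivable1_diffP; exact: differentiable_continuous. Qed.

Lemma is_derive1C_comp (f g : C -> C) z a b :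
  is_derive (g z) 1 f a -> is_derive z 1 g b -> is_derive z 1 (f \o g) (a * b).
Proof.
move=> df dg; apply/is_derive_epsP => e e0.
have b0 := modulus_ge0 b; have a0 := modulus_ge0 a.
set e1 := Num.min 1 (e / (2 * (modulus a + 1))).
have e10 : 0 < e1 by rewrite lt_min ltr01 divr_gt0 //; lra.
set e2 := e / (2 * (modulus b + 1)).
have e20 : 0 < e2 by rewrite divr_gt0 //; lra.
have [d2 d20 H2] := (is_derive_epsP _ _ _).1 df _ e20.
have [d1 d10 H1] := (is_derive_epsP _ _ _).1 dg _ e10.
have /continuous_epsP/(_ _ d20)[d3 d30 H3] : {for z, continuous g}.
  by apply: derivable_cont; case: dg.
exists (Num.min d1 d3); first by rewrite lt_min d10.
move=> w; rewrite lt_min => /andP[/H1 {}H1 /H3/H2 {}H2] /=.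
have -> : f (g w) - f (g z) - a * b * (w - z) =
  (f (g w) - f (g z) - a * (g w - g z)) + a * (g w - g z - b * (w - z)).
  by ring.
apply: le_trans (modulusD _ _) _; rewrite modulusM.
have gw : modulus (g w - g z) <= (modulus b + 1) * modulus (w - z).
  rewrite (_ : g w - g z = (g w - g z - b * (w - z)) + b * (w - z)); last by rewrite subrK.
  apply: le_trans (modulusD _ _) _; rewrite modulusM mulrDl addrC lerD2l.
  by apply: le_trans H1 _; rewrite ler_wpM2r ?modulus_ge0 // ge_min lexx.
have B1 : e2 * modulus (g w - g z) <= e / 2 * modulus (w - z).
  apply: le_trans (ler_wpM2l (ltW e20) gw) _; rewrite mulrA /e2.
  by apply: le_of_eq; field; lra.
have B2 : modulus a * modulus (g w - g z - b * (w - z)) <= e / 2 * modulus (w - z).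
  apply: le_trans (_ : (modulus a + 1) * (e / (2 * (modulus a + 1)) * modulus (w - z)) <= _).
    apply: ler_pM => //; rewrite ?modulus_ge0 //; first by rewrite lerDl.
    by apply: le_trans H1 _; rewrite ler_wpM2r ?modulus_ge0 // ge_min lexx orbT.
  by apply: le_of_eq; field; lra.
by rewrite [X in _ <= X * _](splitr e) mulrDl lerD // (le_trans H2).
Qed.

End basics.

(** * The exponential and the principal logarithm *)

Section cexp.
Context {R : realType}.
Local Notation C := (Cplx R).
Implicit Types (z w : C).

Lemma is_derive_epsRP (f : R -> R) (x l : R) :
  is_derive x 1 f l <-> forall e : R, 0 < e -> exists2 d : R, 0 < d &
    forall y, `|y - x| < d -> `|f y - f x - l * (y - x)| <= e * `|y - x|.
Proof.
have aux (e : R) y : y - x != 0 ->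
  (`|f y - f x - l * (y - x)| <= e * `|y - x|) =
  (`|l - (y - x)^-1 * (f y - f x)| <= e).
  move=> yx; rewrite -ler_pdivrMr ?normr_gt0 // -normfV -normrM.
  by rewrite -normrN -mulNr opprB mulrBl mulfK // [_ / _]mulrC.
split.
  move=> [df dl] e e0.
  have : (h^-1 *: ((f \o shift x) (h *: 1) - f x)) @[h --> (0:R)^'] --> l by rewrite -dl.
  move/cvgrPdist_le => /(_ e e0).
  rewrite near_withinE => /nbhs_ballP[d /= d0 dP]; exists d => // y yd.
  have [->|yx] := eqVneq y x; first by rewrite !subrr mulr0 subr0 normr0 mulr0.
  have yx' : y - x != 0 by rewrite subr_eq0.
  rewrite (aux e y yx'); have := dP (y - x).
  by rewrite /ball /= sub0r normrN => /(_ yd) /(_ yx'); rewrite /GRing.scale /= mulr1 subrK.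
move=> H.
have cvg_l : (h^-1 *: ((f \o shift x) (h *: 1) - f x)) @[h --> (0:R)^'] --> l.
  apply/cvgrPdist_le => e e0.
  have [d d0 dP] := H e e0.
  rewrite near_withinE; apply/nbhs_ballP; exists d => //= h; rewrite /ball /= sub0r normrN => hd h0.
  rewrite /GRing.scale /= mulr1.
  have := dP (h + x); rewrite addrK => /(_ hd).
  by have := aux e (h + x); rewrite addrK => ->.
by split; [apply/cvg_ex; exists l|exact: (cvg_lim (@norm_hausdorff _ _) cvg_l)].
Qed.

Lemma cexpD z w : cexp (z + w) = cexp z * cexp w.
Proof.
case: z w => [a b] [c d]; rewrite /cexp /=.
rewrite expRD cosD sinD.
by apply/eqP; rewrite eq_complex /=; apply/andP; split; apply/eqP; ring.
Qed.

Lemma cexp0 : cexp (0 : C) = 1.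
Proof. by rewrite /cexp /= expR0 cos0 sin0 mulr1 mulr0. Qed.

Lemma modulus_cexp z : modulus (cexp z) = expR (complex.Re z).
Proof.
case: z => a b; rewrite /cexp /modulus /= !exprMn -mulrDr cos2Dsin2 mulr1 sqrtr_sqr.
by rewrite ger0_norm ?expR_ge0.
Qed.

Lemma cexp_neq0 z : cexp z != 0.
Proof. by rewrite -modulus_gt0 modulus_cexp expR_gt0. Qed.

Lemma cexpN z : cexp (- z) = (cexp z)^-1.
Proof.
by apply: (mulfI (cexp_neq0 z)); rewrite -cexpD subrr cexp0 mulfV // cexp_neq0.
Qed.

Lemma cexpMn z n : cexp (z *+ n) = cexp z ^+ n.
Proof. by elim: n => [|n IH]; rewrite ?mulr0n ?cexp0 // mulrS exprS cexpD IH. Qed.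

Lemma is_derive_cexp0 : is_derive (0 : C) 1 (@cexp R) 1.
Proof.
apply/is_derive_epsP => e e0.
set K : R := expR 1; have K0 : 0 < K by exact: expR_gt0.
set e' := e / (2 * K + 2).
have e'0 : 0 < e' by rewrite divr_gt0 //; lra.
have ee' : e = e' * (2 * K + 2) by rewrite divfK //; lra.
have /is_derive_epsRP /(_ e' e'0) [d1 d10 H1] := is_derive_expR (0 : R).
have /is_derive_epsRP /(_ e' e'0) [d2 d20 H2] := is_derive_sin (0 : R).
have /is_derive_epsRP /(_ e' e'0) [d3 d30 H3] := is_derive_cos (0 : R).
have [d4 d40 H4] : exists2 d : R, 0 < d & forall x, `|x| < d -> `|expR x - 1| < e'.
  have /(_ (0:R))/cvgrPdist_lt/(_ e' e'0)/nbhs_ballP[d /= d0 dP] := @continuous_expR R.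
  exists d => // x xd; have := dP x; rewrite /ball /= sub0r normrN => /(_ xd).
  by rewrite expR0 distrC.
exists (Num.min 1 (Num.min (Num.min d1 d2) (Num.min d3 d4))).
  by rewrite !lt_min ltr01 d10 d20 d30 d40.
move=> [x y]; rewrite subr0 !lt_min mul1r => /andP[m1 /andP[/andP[md1 md2] /andP[md3 md4]]].
set m := modulus _ in m1 md1 md2 md3 md4 *.
have xm : `|x| <= m := ge_Re (x +i* y : C)%C.
have ym : `|y| <= m := ge_Im (x +i* y : C)%C.
have m0 : 0 <= m := modulus_ge0 _.
have := H1 x; rewrite subr0 expR0 mul1r => /(_ (le_lt_trans xm md1)) {}H1.
have := H2 y; rewrite subr0 sin0 cos0 subr0 mul1r => /(_ (le_lt_trans ym md2)) {}H2.
have := H3 y; rewrite subr0 cos0 sin0 oppr0 mul0r subr0 => /(_ (le_lt_trans ym md3)) {}H3.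
have {}H4 := H4 x (le_lt_trans xm md4).
have eK : expR x <= K.
  by rewrite ler_expR (le_trans (ler_norm _)) // (le_trans xm) // ltW.
have ex0 : 0 <= expR x by exact: expR_ge0.
apply: le_trans (modulus_le _) _; rewrite cexp0 /=.
have -> : expR x * cos y - 1 - x = (expR x - 1 - x) + expR x * (cos y - 1) by ring.
have -> : expR x * sin y - 0 - y = expR x * (sin y - y) + (expR x - 1) * y by ring.
apply: le_trans (lerD (ler_normD _ _) (ler_normD _ _)) _.
rewrite !normrM (ger0_norm ex0).
have B1 : `|expR x - 1 - x| <= e' * m by apply: le_trans H1 _; rewrite ler_wpM2l // ltW.
have B2 : expR x * `|cos y - 1| <= K * (e' * m).
  by apply: ler_pM => //; apply: le_trans H3 _; rewrite ler_wpM2l // ltW.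
have B3 : expR x * `|sin y - y| <= K * (e' * m).
  by apply: ler_pM => //; apply: le_trans H2 _; rewrite ler_wpM2l // ltW.
have B4 : `|expR x - 1| * `|y| <= e' * m by apply: ler_pM => //; exact: ltW.
rewrite ee'; apply: le_trans (lerD (lerD B1 B2) (lerD B3 B4)) _.
by apply: le_of_eq; ring.
Qed.

Lemma is_derive_cexp z : is_derive z 1 (@cexp R) (cexp z).
Proof.
apply/is_derive_epsP => e e0.
have c0 : 0 < modulus (cexp z) by rewrite modulus_gt0 cexp_neq0.
have [d d0 H] := (is_derive_epsP _ _ _).1 is_derive_cexp0 _ (divr_gt0 e0 c0).
exists d => // w wd; have := H (w - z); rewrite subr0 cexp0 mul1r => /(_ wd) {}H.
have -> : cexp w - cexp z - cexp z * (w - z) = cexp z * (cexp (w - z) - 1 - (w - z)).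
  have -> : cexp w = cexp z * cexp (w - z) by rewrite -cexpD addrC subrK.
  by ring.
rewrite modulusM; apply: le_trans (ler_wpM2l (ltW c0) H) _.
by rewrite mulrA mulrCA divff ?mulr1 // gt_eqF.
Qed.

Lemma derivable_cexp z : derivable (@cexp R : C -> C) z 1.
Proof. by have [] := is_derive_cexp z. Qed.

Lemma cexp_continuous : continuous (@cexp R : C -> C).
Proof. by move=> z; apply: derivable_cont; exact: derivable_cexp. Qed.

(** As the exponential has derivative 1 at 0, [exp k - 1] is comparable to [k]
    for small [k]; this inverts the exponential quantitatively. *)
Lemma cexp_sub1_ge : exists2 d : R, 0 < d & forall k : C, modulus k < d ->
  modulus k <= 2 * modulus (cexp k - 1).
Proof.
have h0 : (0 : R) < 1 / 2 by lra.
have [d d0 H] := (is_derive_epsP _ _ _).1 is_derive_cexp0 _ h0.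
exists d => // k kd; have := H k; rewrite subr0 mul1r cexp0 => /(_ kd) {}H.
have : modulus k <= modulus (cexp k - 1) + modulus (cexp k - 1 - k).
  by rewrite (_ : modulus k = modulus (cexp k - 1 - (cexp k - 1 - k))) ?modulusB // opprB addrC subrK.
lra.
Qed.

(** Any continuous right inverse of the exponential is differentiable: with
    [k = L w - L z], the relation [exp k = w / z] makes [k] comparable to
    [w - z], and then [k = (w - z) / z + o(k)]. *)
Lemma is_derive_log (L : C -> C) z :
  {for z, continuous L} -> (\forall w \near z, cexp (L w) = w) ->
  is_derive z 1 L z^-1.
Proof.
move=> cL /nbhsP[d1 d10 H1]; apply/is_derive_epsP => e e0.
have cz : cexp (L z) = z by apply: H1; rewrite subrr modulus0.
have z0 : z != 0 by rewrite -cz cexp_neq0.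
have mz : 0 < modulus z by rewrite modulus_gt0.
set e' := Num.min (1 / 2) (e * modulus z / 2).
have e'0 : 0 < e' by rewrite lt_min; apply/andP; split; [lra|rewrite divr_gt0 ?mulr_gt0].
have [d2 d20 H2] := (is_derive_epsP _ _ _).1 is_derive_cexp0 _ e'0.
have [d3 d30 H3] := (continuous_epsP _ _).1 cL _ d20.
exists (Num.min d1 d3); first by rewrite lt_min d10.
move=> w; rewrite lt_min => /andP[/H1 cw /H3].
set k := L w - L z => kd; have := H2 k; rewrite subr0 mul1r cexp0 => /(_ kd).
have -> : cexp k = w / z by rewrite /k cexpD cexpN cw cz.
have -> : w / z - 1 = z^-1 * (w - z) by rewrite mulrBr mulVf // mulrC.
set u := _ * _ => H.
rewrite -modulusN opprB; apply: le_trans H _.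
have mu : modulus u = modulus (w - z) / modulus z by rewrite modulusM modulusV mulrC.
have : modulus k <= 2 * modulus u.
  have : modulus k <= modulus u + modulus (u - k).
    by rewrite (_ : modulus k = modulus (u - (u - k))) ?modulusB // opprB addrC subrK.
  have : modulus (u - k) <= 1 / 2 * modulus k.
    have := H2 k; rewrite subr0 mul1r cexp0 => /(_ kd).
    have -> : cexp k = w / z by rewrite /k cexpD cexpN cw cz.
    have -> : w / z - 1 = u by rewrite /u mulrBr mulVf // mulrC.
    move=> h; apply: le_trans h _; rewrite ler_wpM2r ?modulus_ge0 //.
    by rewrite /e' ge_min lexx.
  lra.
move=> /(ler_wpM2l (ltW e'0)) h; apply: le_trans h _.
have : e' * (2 * modulus u) <= e * modulus z / 2 * (2 * modulus u).
  rewrite ler_wpM2r ?mulr_ge0 ?modulus_ge0 //.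
  by rewrite /e' ge_min lexx orbT.
move=> h; apply: le_trans h _; rewrite mu.
by apply: le_of_eq; field; lra.
Qed.

(** The principal logarithm, on the right half-plane. *)
Definition Log z : C :=
  (ln (modulus z) +i* atan (complex.Im z / complex.Re z))%C.

Lemma cexp_Log z : 0 < complex.Re z -> cexp (Log z) = z.
Proof.
case: z => x y /= x0; rewrite /Log /cexp /=.
have z0 : 0 < modulus (x +i* y : C)%C.
  by rewrite modulus_gt0; apply: contraTneq x0 => -[-> _]; rewrite ltxx.
rewrite lnK ?posrE //.
have c0 : cos (atan (y / x)) != 0.
  by rewrite gt_eqF // cos_gt0_pihalf // atan_gtNpi2 atan_ltpi2.
have -> : sin (atan (y / x)) = y / x * cos (atan (y / x)).
  by rewrite -{2}(atanK (y / x)) /tan divfK.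
rewrite cos_atan.
have -> : modulus (x +i* y : C)%C = x * Num.sqrt (1 + (y / x) ^+ 2).
  rewrite /modulus /= -[X in X * _](ger0_norm (ltW x0)) -sqrtr_sqr -sqrtrM ?sqr_ge0 //.
  by congr Num.sqrt; field; lra.
have s0 : Num.sqrt (1 + (y / x) ^+ 2) != 0.
  by rewrite gt_eqF // sqrtr_gt0 ltr_pwDl // sqr_ge0.
apply/eqP; rewrite eq_complex /=; apply/andP; split; apply/eqP.
  by rewrite mulfK.
by field; rewrite s0 gt_eqF.
Qed.

Lemma Log1 : Log 1 = 0.
Proof. by rewrite /Log modulus1 ln1 /= mul0r atan0. Qed.

Lemma is_derive_Log z : 0 < complex.Re z -> is_derive z 1 Log z^-1.
Proof.
move=> x0.
have z0 : 0 < modulus z by apply: lt_le_trans (ge_Re z); rewrite normr_gt0 gt_eqF.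
apply: is_derive_log.
  have c1 : {for z, continuous ((@ln R) \o (@modulus R))}.
    by apply: continuous_comp; [exact: modulus_continuous|exact: continuous_ln].
  have c2 : {for z, continuous (fun w : C => complex.Im w / complex.Re w)}.
    apply: (@cvgM _ _ (nbhs z)); first exact: Im_continuous.
    by apply: (@cvgV _ _ (nbhs z)); [rewrite gt_eqF|exact: Re_continuous].
  have c3 : {for z, continuous ((@atan R) \o (fun w : C => complex.Im w / complex.Re w))}.
    by apply: continuous_comp; [exact: c2|exact: continuous_atan].
  exact: Complex_cvg c1 c3.
have := @Re_continuous R z; move/cvgrPdist_lt => /(_ _ x0).
apply: filterS => w h; apply: cexp_Log.
by move: h; rewrite ltr_norml => /andP[_]; lra.
Qed.

End cexp.

(** * Integrals of complex-valued functions of a real variable *)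

Section cint.
Context {R : realType}.
Local Notation C := (Cplx R).
Local Notation mu := (@lebesgue_measure R).
Implicit Types (f g : R -> C) (a b t : R).

Definition cint f a b : C :=
  ((\int[mu]_(t in `[a, b]) complex.Re (f t)) +i*
   (\int[mu]_(t in `[a, b]) complex.Im (f t)))%C.

Arguments cint : simpl never.

Definition cont_itv f a b := forall t, a <= t <= b -> {for t, continuous f}.

Lemma cont_itv_Re f a b : cont_itv f a b ->
  mu.-integrable `[a, b] (EFin \o (fun t => complex.Re (f t))).
Proof.
move=> cf; apply: continuous_compact_integrable; first exact: segment_compact.
apply: continuous_in_subspaceT => t /set_mem /=; rewrite in_itv /= => /cf ct.
have : {for t, continuous ((@complex.Re R : C -> R) \o f)}.
  by apply: continuous_comp; [exact: ct|exact: Re_continuous].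
exact.
Qed.

Lemma cont_itv_Im f a b : cont_itv f a b ->
  mu.-integrable `[a, b] (EFin \o (fun t => complex.Im (f t))).
Proof.
move=> cf; apply: continuous_compact_integrable; first exact: segment_compact.
apply: continuous_in_subspaceT => t /set_mem /=; rewrite in_itv /= => /cf ct.
have : {for t, continuous ((@complex.Im R : C -> R) \o f)}.
  by apply: continuous_comp; [exact: ct|exact: Im_continuous].
exact.
Qed.

Lemma eq_cint f g a b : (forall t, a <= t <= b -> f t = g t) -> cint f a b = cint g a b.
Proof.
by move=> fg; rewrite /cint; congr (_ +i* _)%C; apply: eq_Rintegral => t /set_mem /=;
  rewrite in_itv /= => /fg ->.
Qed.

Lemma cintD f g a b : cont_itv f a b -> cont_itv g a b ->
  cint (fun t => f t + g t) a b = cint f a b + cint g a b.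
Proof.
move=> cf cg; rewrite /cint.
have -> : (fun t => complex.Re (f t + g t)) = (fun t => complex.Re (f t) + complex.Re (g t)).
  by apply/funext => t; case: (f t) (g t) => ? ? [].
have -> : (fun t => complex.Im (f t + g t)) = (fun t => complex.Im (f t) + complex.Im (g t)).
  by apply/funext => t; case: (f t) (g t) => ? ? [].
by rewrite !RintegralD //; [exact: cont_itv_Im|exact: cont_itv_Im|exact: cont_itv_Re|exact: cont_itv_Re].
Qed.

Lemma cintZ (k : C) f a b : cont_itv f a b ->
  cint (fun t => k * f t) a b = k * cint f a b.
Proof.
move=> cf; rewrite /cint.
have iR := cont_itv_Re cf; have iI := cont_itv_Im cf.
have iRZ (x : R) : mu.-integrable `[a, b] (EFin \o (fun t => x * complex.Re (f t))).
  suff : mu.-integrable `[a, b] (fun t => x%:E * (complex.Re (f t))%:E)%E by [].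
  exact: integrableZl.
have iIZ (x : R) : mu.-integrable `[a, b] (EFin \o (fun t => x * complex.Im (f t))).
  suff : mu.-integrable `[a, b] (fun t => x%:E * (complex.Im (f t))%:E)%E by [].
  exact: integrableZl.
case: k => x y.
have -> : (fun t => complex.Re ((x +i* y)%C * f t : C)) =
    (fun t => x * complex.Re (f t) - y * complex.Im (f t)).
  by apply/funext => t; case: (f t).
have -> : (fun t => complex.Im ((x +i* y)%C * f t : C)) =
    (fun t => x * complex.Im (f t) + y * complex.Re (f t)).
  by apply/funext => t; case: (f t).
by rewrite RintegralB // RintegralD // !RintegralZl.
Qed.

Lemma cintB f g a b : cont_itv f a b -> cont_itv g a b ->
  cint (fun t => f t - g t) a b = cint f a b - cint g a b.
Proof.
move=> cf cg.
have -> : (fun t => f t - g t) = (fun t => f t + (-1) * g t).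
  by apply/funext => t; rewrite mulN1r.
have cg' : cont_itv (fun t => (-1) * g t) a b.
  by move=> t /cg ct; apply: (@cvgM _ _ (nbhs t)); [exact: cvg_cst|exact: ct].
by rewrite (cintD cf cg') (cintZ _ cg) mulN1r.
Qed.

Lemma cint_cst (k : C) a b : a <= b -> cint (fun=> k) a b = k * of_real (b - a).
Proof.
move=> ab; rewrite /cint !Rintegral_cst //= lebesgue_measure_itv /= lte_fin.
case: k => x y; apply/eqP; rewrite eq_complex /=.
move: ab; rewrite le_eqVlt => /predU1P[->|ab].
  by rewrite ltxx /= subrr !mulr0 subr0 addr0 !eqxx.
by rewrite ab /= !mulr0 subr0 add0r !eqxx.
Qed.

Lemma cint_split f a m b : a <= m <= b -> cont_itv f a b ->
  cint f a b = cint f a m + cint f m b.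
Proof.
move=> /andP[am mb] cf.
have iR := cont_itv_Re cf; have iI := cont_itv_Im cf.
have cmb : cont_itv f m b.
  by move=> t /andP[mt tb]; apply: cf; rewrite tb (le_trans am mt).
have H (g : R -> R) : mu.-integrable `[a, b] (EFin \o g) ->
    mu.-integrable `[m, b] (EFin \o g) ->
    \int[mu]_(t in `[a, b]) g t = \int[mu]_(t in `[a, m]) g t + \int[mu]_(t in `[m, b]) g t.
  move=> ig ig'; apply/eqP; rewrite addrC -subr_eq.
  rewrite Rintegral_itvB //=.
  by rewrite Rintegral_itv_obnd_cbnd //; apply: integrableS ig => // x /=;
    rewrite !in_itv /= => /andP[mx ->]; rewrite andbT (le_trans am) // ltW.
by rewrite /cint (H _ iR (cont_itv_Re cmb)) (H _ iI (cont_itv_Im cmb)).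
Qed.

(** The real and the imaginary part are bounded separately, whence the factor
    2. *)
Lemma le_cint f a b (M : R) : a <= b -> cont_itv f a b ->
  (forall t, a <= t <= b -> modulus (f t) <= M) ->
  modulus (cint f a b) <= 2 * M * (b - a).
Proof.
move=> ab cf fM.
have H (g : R -> R) : mu.-integrable `[a, b] (EFin \o g) ->
    (forall t, a <= t <= b -> `|g t| <= M) -> `|\int[mu]_(t in `[a, b]) g t| <= M * (b - a).
  move=> ig gM; apply: le_trans (le_normr_Rintegral _ ig) _ => //.
  have -> : M * (b - a) = \int[mu]_(t in `[a, b]) M.
    rewrite Rintegral_cst //= lebesgue_measure_itv /= lte_fin.
    by move: ab; rewrite le_eqVlt => /predU1P[->|->] //; rewrite ltxx subrr.
  apply: le_Rintegral => //.
  - exact: integrable_norm.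
  - apply: continuous_compact_integrable; first exact: segment_compact.
    by apply: continuous_subspaceT => x; exact: cvg_cst.
apply: le_trans (modulus_le _) _; rewrite /cint /=.
rewrite (_ : 2 * M * (b - a) = M * (b - a) + M * (b - a)); last by ring.
apply: lerD; apply: H.
- exact: cont_itv_Re.
- by move=> t /fM; exact/le_trans/ge_Re.
- exact: cont_itv_Im.
- by move=> t /fM; exact/le_trans/ge_Im.
Qed.

End cint.

(** * Bisection of rectangles *)

Section bisection.
Context {R : realType}.

Definition half (i : bool) (I : R * R) : R * R :=
  let m := (I.1 + I.2) / 2 in if i then (m, I.2) else (I.1, m).

Lemma nested_halves (I : nat -> R * R) (i : nat -> bool) :
  (I 0%N).1 <= (I 0%N).2 -> (forall n, I n.+1 = half (i n) (I n)) ->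
  [/\ forall n, (I n).1 <= (I n).2,
      forall n, (I n).2 - (I n).1 = ((I 0%N).2 - (I 0%N).1) / 2 ^+ n,
      forall n, (I 0%N).1 <= (I n).1 /\ (I n).2 <= (I 0%N).2 &
      exists x, forall n, (I n).1 <= x <= (I n).2].
Proof.
move=> I0 IS.
have Ile n : (I n).1 <= (I n).2.
  elim: n => [//|n IH]; rewrite IS /half; case: (i n) => /=; lra.
have Iw n : (I n).2 - (I n).1 = ((I 0%N).2 - (I 0%N).1) / 2 ^+ n.
  elim: n => [|n IH]; first by rewrite expr0 divr1.
  rewrite exprSr invfM mulrA -IH IS /half; case: (i n) => /=; lra.
have mono1 n k : (I n).1 <= (I (k + n)%N).1.
  elim: k => [//|k IH]; rewrite addSn IS /half; apply: le_trans IH _.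
  by have := Ile (k + n)%N; case: (i _) => /=; lra.
have mono2 n k : (I (k + n)%N).2 <= (I n).2.
  elim: k => [//|k IH]; rewrite addSn IS /half; apply: le_trans IH.
  by have := Ile (k + n)%N; case: (i _) => /=; lra.
have cross n m : (I n).1 <= (I m).2.
  apply: le_trans (mono1 n m) _; apply: le_trans (Ile _) _.
  by rewrite addnC; exact: mono2.
split => //; first by move=> n; have := mono1 0%N n; have := mono2 0%N n; rewrite addn0.
exists (sup (range (fun n => (I n).1))) => n.
have hs : has_sup (range (fun n => (I n).1)).
  by split; [exists (I 0%N).1; exists 0%N|exists (I 0%N).2 => _ [m _ <-]; exact: cross].
apply/andP; split; first by apply: ub_le_sup; [case: hs|exists n].
by apply: ge_sup; [case: hs|move=> _ [m _ <-]; exact: cross].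
Qed.

Definition subitv (I J : R * R) := J.1 <= I.1 /\ I.2 <= J.2.

(** If [P] failed on the rectangle it would fail on one of its quarters, and so
    on; the nested rectangles obtained this way shrink to a point, where [P]
    holds on all small rectangles. *)
Lemma rectangle_bisection (P : R * R -> R * R -> Prop) (I0 J0 : R * R) :
  I0.1 <= I0.2 -> J0.1 <= J0.2 ->
  (forall I J, I.1 <= I.2 -> J.1 <= J.2 -> subitv I I0 -> subitv J J0 ->
     (forall i j, P (half i I) (half j J)) -> P I J) ->
  (forall x y, I0.1 <= x <= I0.2 -> J0.1 <= y <= J0.2 ->
     exists2 d : R, 0 < d & forall I J, subitv I I0 -> subitv J J0 ->
       I.1 <= x <= I.2 -> J.1 <= y <= J.2 -> I.2 - I.1 < d -> J.2 - J.1 < d -> P I J) ->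
  P I0 J0.
Proof.
move=> I0le J0le glue loc; apply: contrapT => nP.
pose K (r : (R * R) * (R * R)) (e : bool * bool) := (half e.1 r.1, half e.2 r.2).
have /choice[ch chP] : forall r : (R * R) * (R * R), exists e : bool * bool,
    (forall e', P (K r e').1 (K r e').2) \/ ~ P (K r e).1 (K r e).2.
  move=> r; have [A|] := pselect (forall e', P (K r e').1 (K r e').2).
    by exists (true, true); left.
  by move=> /existsNP[e he]; exists e; right.
pose r n := iter n (fun r => K r (ch r)) (I0, J0).
have rS n : r n.+1 = K (r n) (ch (r n)) by [].
have [I1 I2 I3 [x xP]] := nested_halves (I := fun n => (r n).1) (i := fun n => (ch (r n)).1)
  I0le (fun n => erefl).
have [J1 J2 J3 [y yP]] := nested_halves (I := fun n => (r n).2) (i := fun n => (ch (r n)).2)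
  J0le (fun n => erefl).
have nPr n : ~ P (r n).1 (r n).2.
  elim: n => [//|n IH]; rewrite rS; have [A|//] := chP (r n).
  exfalso; apply: IH; apply: glue => //.
  by move=> i j; exact: (A (i, j)).
have [d d0 dP] := loc x y (xP 0%N) (yP 0%N).
have small (w : R) : exists n0, forall n, (n0 <= n)%N -> w / 2 ^+ n < d.
  exists (Num.truncn (w / d)).+1 => n hn.
  rewrite ltr_pdivrMr ?exprn_gt0 // mulrC -ltr_pdivrMr //.
  apply: lt_trans (truncnS_gt _) _.
  apply: (@le_lt_trans _ _ n%:R); first by rewrite ler_nat.
  by rewrite -natrX ltr_nat ltn_expl.
have [n1 H1] := small (I0.2 - I0.1).
have [n2 H2] := small (J0.2 - J0.1).
pose n := maxn n1 n2.
apply: (nPr n); apply: dP => //.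
  by rewrite I2; apply: H1; rewrite leq_maxl.
by rewrite J2; apply: H2; rewrite leq_maxr.
Qed.

End bisection.

(** * Goursat's theorem and Fourier coefficients on circles *)

Section goursat.
Context {R : realType}.
Local Notation C := (Cplx R).
Implicit Types (h : C -> C) (I J : R * R).

Lemma horizontal_cont h a b y :
  (forall x, a <= x <= b -> derivable h (x +i* y : C)%C 1) ->
  cont_itv (fun x => h (x +i* y)%C) a b.
Proof.
move=> dh x xab.
have : {for x, continuous (h \o (fun x => (x +i* y : C)%C))}.
  apply: continuous_comp; last by apply: derivable_cont; exact: dh.
  by apply: Complex_cvg; [exact: cvg_id|exact: cvg_cst].
exact.
Qed.

Lemma vertical_cont h a b x :
  (forall y, a <= y <= b -> derivable h (x +i* y : C)%C 1) ->
  cont_itv (fun y => h (x +i* y)%C) a b.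
Proof.
move=> dh y yab.
have : {for y, continuous (h \o (fun y => (x +i* y : C)%C))}.
  apply: continuous_comp; last by apply: derivable_cont; exact: dh.
  by apply: Complex_cvg; [exact: cvg_cst|exact: cvg_id].
exact.
Qed.

Definition imag : C := (0 +i* 1)%C.

(** The integral of [h dz] along the boundary of the rectangle [I x J]. *)
Definition rectint h I J : C :=
  cint (fun x => h (x +i* J.1)%C) I.1 I.2 - cint (fun x => h (x +i* J.2)%C) I.1 I.2
  + imag * (cint (fun y => h (I.2 +i* y)%C) J.1 J.2 - cint (fun y => h (I.1 +i* y)%C) J.1 J.2).

Arguments rectint : simpl never.

Definition deriv_rect h I J := forall x y, I.1 <= x <= I.2 -> J.1 <= y <= J.2 ->
  derivable h (x +i* y : C)%C 1.

Lemma rectint_quarters h I J : I.1 <= I.2 -> J.1 <= J.2 -> deriv_rect h I J ->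
  rectint h I J =
    rectint h (half false I) (half false J) + rectint h (half false I) (half true J) +
    (rectint h (half true I) (half false J) + rectint h (half true I) (half true J)).
Proof.
case: I J => [a b] [c d] /= ab cd dh; rewrite /rectint /half /=.
set m := (a + b) / 2; set n := (c + d) / 2.
have am : a <= m by rewrite /m; lra.
have mb : m <= b by rewrite /m; lra.
have cn : c <= n by rewrite /n; lra.
have nd : n <= d by rewrite /n; lra.
have H y : c <= y <= d -> cint (fun x => h (x +i* y)%C) a b =
    cint (fun x => h (x +i* y)%C) a m + cint (fun x => h (x +i* y)%C) m b.
  move=> yd; apply: cint_split; first by rewrite am.
  by apply: horizontal_cont => x xab; exact: dh.
have V x : a <= x <= b -> cint (fun y => h (x +i* y)%C) c d =
    cint (fun y => h (x +i* y)%C) c n + cint (fun y => h (x +i* y)%C) n d.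
  move=> xb; apply: cint_split; first by rewrite cn.
  by apply: vertical_cont => y ycd; exact: dh.
rewrite H ?lexx ?cd // (H d) ?lexx ?cd //.
rewrite (V a) ?lexx ?ab // (V b) ?lexx ?ab //.
ring.
Qed.

(** An affine function has zero integral along the boundary, so only the
    deviation of [h] from its tangent at a point of the rectangle counts. *)
Lemma rectint_le h I J (w0 l : C) (e : R) : I.1 <= I.2 -> J.1 <= J.2 ->
  deriv_rect h I J ->
  (forall x y, I.1 <= x <= I.2 -> J.1 <= y <= J.2 ->
     modulus (h (x +i* y)%C - (w0 + l * (x +i* y : C)%C)) <= e) ->
  modulus (rectint h I J) <= 4 * e * ((I.2 - I.1) + (J.2 - J.1)).
Proof.
case: I J => [a b] [c d] /= ab cd dh he.
pose k (z : C) := h z - (w0 + l * z).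
have daff z : derivable (fun z : C => w0 + l * z) z 1.
  apply: derivableD; first exact: derivable_cst.
  by apply: derivableM; [exact: derivable_cst|exact: derivable_id].
have dk : deriv_rect k (a, b) (c, d).
  by move=> x y xI yJ; apply: derivableB; [exact: dh|exact: daff].
have caffH a' b' y : cont_itv (fun x => w0 + l * (x +i* y : C)%C) a' b'.
  by apply: (@horizontal_cont (fun z => w0 + l * z)) => x _; exact: daff.
have caffV a' b' x : cont_itv (fun y => w0 + l * (x +i* y : C)%C) a' b'.
  by apply: (@vertical_cont (fun z => w0 + l * z)) => y _; exact: daff.
have cH y : c <= y <= d -> cont_itv (fun x => h (x +i* y)%C) a b.
  by move=> ycd; apply: horizontal_cont => x xab; exact: dh.
have cV x : a <= x <= b -> cont_itv (fun y => h (x +i* y)%C) c d.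
  by move=> xab; apply: vertical_cont => y ycd; exact: dh.
have cc : c <= c <= d by rewrite lexx.
have dd : c <= d <= d by rewrite lexx cd.
have aa : a <= a <= b by rewrite lexx.
have bb : a <= b <= b by rewrite lexx ab.
have aff0 : rectint (fun z => w0 + l * z) (a, b) (c, d) = 0.
  rewrite /rectint /=.
  rewrite -(cintB (caffH _ _ c) (caffH _ _ d)) -(cintB (caffV _ _ b) (caffV _ _ a)).
  rewrite (@eq_cint _ _ (fun=> l * (0 +i* (c - d))%C) a b); last first.
    move=> t _; rewrite opprD addrACA subrr add0r -mulrBr; congr (_ * _).
    by apply/eqP; rewrite eq_complex /= subrr !eqxx.
  rewrite (@eq_cint _ _ (fun=> l * ((b - a) +i* 0)%C) c d); last first.
    move=> t _; rewrite opprD addrACA subrr add0r -mulrBr; congr (_ * _).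
    by apply/eqP; rewrite eq_complex /= subrr !eqxx.
  rewrite !cint_cst // -!mulrA [imag * _]mulrCA -mulrDr.
  apply/eqP; rewrite mulf_eq0; apply/orP; right.
  by rewrite eq_complex /=; apply/andP; split; apply/eqP; ring.
have -> : rectint h (a, b) (c, d) = rectint k (a, b) (c, d).
  rewrite -[LHS]subr0 -aff0 /rectint /= /k.
  rewrite !cintB //; [|exact: cV|exact: cV|exact: cH|exact: cH].
  ring.
rewrite /rectint /=.
have ckH y : c <= y <= d -> cont_itv (fun x => k (x +i* y)%C) a b.
  by move=> ycd; apply: horizontal_cont => x xab; exact: dk.
have ckV x : a <= x <= b -> cont_itv (fun y => k (x +i* y)%C) c d.
  by move=> xab; apply: vertical_cont => y ycd; exact: dk.
have leH y : c <= y <= d -> modulus (cint (fun x => k (x +i* y)%C) a b) <= 2 * e * (b - a).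
  by move=> ycd; apply: le_cint => // [|t tab]; [exact: ckH|exact: he].
have leV x : a <= x <= b -> modulus (cint (fun y => k (x +i* y)%C) c d) <= 2 * e * (d - c).
  by move=> xab; apply: le_cint => // [|t tab]; [exact: ckV|exact: he].
apply: le_trans (modulusD _ _) _; rewrite modulusM.
have -> : modulus imag = 1 by rewrite /imag /modulus /= expr0n expr1n add0r sqrtr1.
rewrite mul1r.
apply: le_trans (lerD (modulusB _ _) (modulusB _ _)) _.
apply: le_trans (lerD (lerD (leH c cc) (leH d dd)) (lerD (leV b bb) (leV a aa))) _.
by apply: le_of_eq; ring.
Qed.

(** The bound [e * s ^ 2], with [s] half the perimeter, is inherited from the
    four quarters of a rectangle, because each has half its perimeter. Near a
    point it follows from differentiability there, without any continuity of the
    derivative. *)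
Lemma goursat h I J : I.1 <= I.2 -> J.1 <= J.2 -> deriv_rect h I J ->
  rectint h I J = 0.
Proof.
move=> Ile Jle dh; apply/eqP; rewrite -modulus_eq0 eq_le modulus_ge0 andbT.
set s := (I.2 - I.1) + (J.2 - J.1).
have s0 : 0 <= s by rewrite /s; lra.
have sub I' J' : subitv I' I -> subitv J' J -> deriv_rect h I' J'.
  move=> [I1 I2] [J1 J2] x y /andP[x1 x2] /andP[y1 y2]; apply: dh.
    by rewrite (le_trans I1 x1) (le_trans x2 I2).
  by rewrite (le_trans J1 y1) (le_trans y2 J2).
suff H e : 0 < e -> modulus (rectint h I J) <= e * s ^+ 2.
  apply/ler_addgt0Pl => e e0; rewrite addr0.
  apply: le_trans (H (e / (s ^+ 2 + 1)) _) _.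
    by rewrite divr_gt0 // ltr_wpDl // sqr_ge0.
  have s2 := sqr_ge0 s.
  rewrite mulrAC ler_pdivrMr ?ltr_wpDl //.
  by rewrite ler_wpM2l ?(ltW e0) // lerDl.
move=> e0.
pose P I J := modulus (rectint h I J) <= e * ((I.2 - I.1) + (J.2 - J.1)) ^+ 2.
apply: (@rectangle_bisection _ P) => //.
  move=> I' J' I'le J'le sI sJ PQ; rewrite /P.
  rewrite rectint_quarters //; last exact: sub.
  have q i j : modulus (rectint h (half i I') (half j J')) <=
      e * ((I'.2 - I'.1) + (J'.2 - J'.1)) ^+ 2 / 4.
    apply: le_trans (PQ i j) _; apply: le_of_eq.
    by rewrite /half; case: i j => -[] /=; field.
  apply: le_trans (modulusD _ _) _.
  apply: le_trans (lerD (modulusD _ _) (modulusD _ _)) _.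
  apply: le_trans (lerD (lerD (q _ _) (q _ _)) (lerD (q _ _) (q _ _))) _.
  by apply: le_of_eq; field.
move=> x y xI yJ.
have e8 : 0 < e / 4 by rewrite divr_gt0.
have /derivableP/is_derive_epsP/(_ _ e8)[d d0 dP] := dh x y xI yJ.
set l := 'D_1 h _ in dP.
exists (d / 2); first by rewrite divr_gt0.
move=> I' J' sI sJ /andP[x1 x2] /andP[y1 y2] wI wJ; rewrite /P.
set s' := _ - _ + (_ - _).
set z0 : C := (x +i* y)%C in dP.
have s'0 : 0 <= s' by rewrite /s'; lra.
rewrite (_ : e * s' ^+ 2 = 4 * (e / 4 * s') * s'); last by field.
apply: (@rectint_le _ _ _ (h z0 - l * z0) l); [lra|lra|exact: sub|].
move=> u v /andP[u1 u2] /andP[v1 v2].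
set w : C := (u +i* v)%C.
have wz : modulus (w - z0) <= s'.
  apply: le_trans (modulus_le _) _ => /=.
  by rewrite lerD // ler_norml; lra.
rewrite (_ : h w - _ = h w - h z0 - l * (w - z0)); last by ring.
apply: le_trans (dP w _) _; last by rewrite ler_wpM2l // ltW.
by apply: le_lt_trans wz _; rewrite /s'; lra.
Qed.

Lemma cexp_2pi_i : cexp (0 +i* (pi *+ 2) : C)%C = 1.
Proof.
by rewrite /cexp /= expR0 cos2pi sin2pi !mul1r.
Qed.

(** In logarithmic coordinates a circle centred at 0 is a vertical segment of
    length [2 pi]; by periodicity the horizontal sides of the rectangle between
    two such segments contribute opposite integrals. *)
Lemma vertical_cint_const h s1 s2 : s1 <= s2 ->
  (forall w : C, s1 <= complex.Re w <= s2 -> derivable h w 1) ->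
  (forall w, h (w + (0 +i* (pi *+ 2))%C) = h w) ->
  cint (fun t => h (s1 +i* t)%C) 0 (pi *+ 2) = cint (fun t => h (s2 +i* t)%C) 0 (pi *+ 2).
Proof.
move=> s12 dh per.
have pi0 : 0 <= pi *+ 2 :> R by rewrite mulrn_wge0 // pi_ge0.
(* The two horizontal sides carry the same integral. *)
have := @goursat h (s1, s2) (0, pi *+ 2) s12 pi0.
have dr : deriv_rect h (s1, s2) (0, pi *+ 2) by move=> x y xI _; exact: dh.
move=> /(_ dr); rewrite /rectint /=.
rewrite (@eq_cint _ (fun x => h (x +i* (pi *+ 2))%C) (fun x => h (x +i* 0)%C)); last first.
  move=> t _; rewrite -[RHS]per; congr h.
  by apply/eqP; rewrite eq_complex /= addr0 add0r !eqxx.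
rewrite subrr add0r => /eqP; rewrite mulf_eq0 => /orP[/eqP[/eqP]|].
  by rewrite oner_eq0.
by rewrite subr_eq0 => /eqP ->.
Qed.

(** [f = o(z ^ n)] at the origin. Since the bound is also required at [z = 0],
    it forces [f 0 = 0]. *)
Definition flat n (f : C -> C) := forall e : R, 0 < e -> exists2 d : R, 0 < d &
  forall z, modulus z < d -> modulus (f z) <= e * modulus z ^+ n.

(** The Fourier coefficient of index [j] of an analytic function on the circle
    of radius [r], divided by [r ^ j], is independent of [r]; it vanishes when
    the function is [o(z ^ j)] at 0, as one sees by letting [r] tend to 0. *)
Lemma circle_coef_eq0 (H : C -> C) (d : R) (j : nat) : 1 < d ->
  (forall z, modulus z < d -> derivable H z 1) ->
  flat j H ->
  cint (fun t => H (cexp (0 +i* t)%C) * (cexp (0 +i* t)%C) ^- j) 0 (pi *+ 2) = 0.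
Proof.
move=> d1 dH small.
pose h (w : C) := H (cexp w) * (cexp (w * (- j%:R))).
have hE w : h w = H (cexp w) * (cexp w) ^- j.
  by rewrite /h mulrN cexpN mulr_natr cexpMn.
have dh (w : C) : complex.Re w <= 0 -> derivable h w 1.
  move=> w0; apply: derivableM.
    have dHw : derivable H (cexp w) 1.
      by apply: dH; rewrite modulus_cexp (le_lt_trans _ d1) // -expR0 ler_expR.
    by have [] := is_derive1C_comp (derivableP dHw) (is_derive_cexp w).
  have dlin : derivable (fun z : C => z * (- j%:R)) w 1.
    by apply: derivableM; [exact: derivable_id|exact: derivable_cst].
  by have [] := @is_derive1C_comp _ (@cexp R) _ w _ _ (is_derive_cexp _) (derivableP dlin).
have per w : h (w + (0 +i* (pi *+ 2))%C) = h w.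
  by rewrite !hE cexpD cexp_2pi_i mulr1.
under eq_cint do rewrite -hE.
have pi0 : 0 < pi *+ 2 :> R by rewrite mulrn_wgt0 // pi_gt0.
apply/eqP; rewrite -modulus_eq0 eq_le modulus_ge0 andbT.
apply/ler_addgt0Pl => e e0; rewrite addr0.
have ep : 0 < e / (2 * (pi *+ 2)) by rewrite divr_gt0 // mulr_gt0.
have [r r0 rP] := small _ ep.
(* The circle of radius [exp s] lies where [H] is small. *)
set s := Num.min 0 (ln (r / 2)).
have r20 : 0 < r / 2 by rewrite divr_gt0.
have s0 : s <= 0 by rewrite /s ge_min lexx.
have sr : expR s < r.
  apply: (@le_lt_trans _ _ (r / 2)); last lra.
  by rewrite -[leRHS]lnK ?posrE // ler_expR /s ge_min lexx orbT.
rewrite -(@vertical_cint_const h s 0) //; last first.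
  by move=> w /andP[_]; exact: dh.
have cv : cont_itv (fun t => h (s +i* t)%C) 0 (pi *+ 2).
  by apply: vertical_cont => y _; exact: dh.
apply: le_trans (le_cint (ltW pi0) cv (M := e / (2 * (pi *+ 2))) _) _; last first.
  by apply: le_of_eq; rewrite subr0; field; lra.
move=> t _; rewrite hE modulusM modulusV modulusX.
have m : modulus (cexp (s +i* t : C)%C) = expR s by rewrite modulus_cexp.
have E0 : 0 < expR s ^+ j by rewrite exprn_gt0 // expR_gt0.
rewrite m ler_pdivrMr //.
by have := rP (cexp (s +i* t)%C); rewrite m; exact.
Qed.

End goursat.

(** * The mean value inequality *)

Section mean_value.
Context {R : realType}.
Local Notation C := (Cplx R).
Implicit Types (f : C -> C) (u v z : C).

Lemma of_realB (s t : R) : of_real (s - t) = of_real s - of_real t :> C.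
Proof. exact: (rmorphB (real_complex R)). Qed.

Lemma of_realM (s t : R) : of_real (s * t) = of_real s * of_real t :> C.
Proof. exact: (rmorphM (real_complex R)). Qed.

Lemma of_real_eq0 (s : R) : (of_real s == 0 :> C) = (s == 0).
Proof. by rewrite -modulus_eq0 modulus_real normr_eq0. Qed.

Lemma line_is_derive (rho : C -> R) f u v (t : R) :
  (forall z w, rho (z - w) = rho z - rho w) ->
  (forall s z, rho (of_real s * z) = s * rho z) ->
  (forall z, `|rho z| <= modulus z) ->
  derivable f (u + of_real t * v) 1 ->
  is_derive t (1 : R) (fun s => rho (f (u + of_real s * v)))
    (rho (derive1 f (u + of_real t * v) * v)).
Proof.
move=> rhoB rhoZ rhole df; apply/is_derive_epsRP => e e0.
have m0 := modulus_ge0 v.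
have e'0 : 0 < e / (modulus v + 1) by rewrite divr_gt0 // ltr_wpDl.
have /derivableP/is_derive_epsP/(_ _ e'0)[d d0 dP] := df.
exists (d / (modulus v + 1)); first by rewrite divr_gt0 // ltr_wpDl.
move=> s st.
have E : u + of_real s * v - (u + of_real t * v) = of_real (s - t) * v.
  by rewrite opprD addrACA subrr add0r -mulrBl -of_realB.
have := dP (u + of_real s * v); rewrite E modulusM modulus_real => /(_ _) H.
have st' : `|s - t| * (modulus v + 1) < d by rewrite -ltr_pdivlMr // ltr_wpDl.
have {}H := H (le_lt_trans (ler_wpM2l (normr_ge0 _) _) st').
have {}H := H ltac:(by rewrite lerDl).
rewrite -rhoB [_ * (s - t)]mulrC -rhoZ -rhoB.
apply: le_trans (rhole _) _; rewrite derive1E mulrCA (le_trans H) //.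
rewrite mulrAC ler_pdivrMr ?ltr_wpDl // -mulrA ler_wpM2l ?(ltW e0) //.
by rewrite ler_wpM2l // lerDl.
Qed.

(** The mean value theorem is applied to the real and to the imaginary part
    along the segment, whence the factor 2. *)
Lemma mean_value_le f u v (M : R) :
  (forall t : R, 0 <= t <= 1 -> derivable f (u + of_real t * v) 1) ->
  (forall t : R, 0 <= t <= 1 -> modulus (derive1 f (u + of_real t * v)) <= M) ->
  modulus (f (u + v) - f u) <= 2 * M * modulus v.
Proof.
move=> df fM.
have main (rho : C -> R) : (forall z w, rho (z - w) = rho z - rho w) ->
  (forall s z, rho (of_real s * z) = s * rho z) ->
  (forall z, `|rho z| <= modulus z) -> `|rho (f (u + v) - f u)| <= M * modulus v.
  move=> rhoB rhoZ rhole.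
  pose g s := rho (f (u + of_real s * v)).
  pose dg s := rho (derive1 f (u + of_real s * v) * v).
  have gd (t : R) : 0 <= t <= 1 -> is_derive t (1 : R) g (dg t).
    by move=> t01; apply: line_is_derive => //; exact: df.
  have gd' (t : R) : t \in `]0, 1[ -> is_derive t (1 : R) g (dg t).
    by rewrite in_itv /= => /andP[t0 t1]; apply: gd; rewrite !ltW.
  have gc : {within `[0, 1], continuous g}.
    apply: continuous_in_subspaceT => t /set_mem /=; rewrite in_itv /= => /gd[dgt _].
    exact/differentiable_continuous/derivable1_diffP.
  have [t] := MVT_segment ler01 gd' gc.
  rewrite in_itv /= /g => t01.
  have -> : of_real 1 * v = v by rewrite [of_real 1](_ : _ = 1) ?mul1r.
  have -> : of_real 0 * v = 0 by rewrite [of_real 0](_ : _ = 0) ?mul0r.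
  rewrite addr0 subr0 mulr1 rhoB => ->.
  apply: le_trans (rhole _) _; rewrite modulusM ler_wpM2r ?modulus_ge0 //.
  exact: fM.
apply: le_trans (modulus_le _) _.
rewrite (_ : 2 * M * modulus v = M * modulus v + M * modulus v); last by ring.
apply: lerD; apply: main.
- by move=> [? ?] [? ?].
- by move=> s [x y]; rewrite /of_real /= mul0r subr0.
- exact: ge_Re.
- by move=> [? ?] [? ?].
- by move=> s [x y]; rewrite /of_real /= mul0r addr0.
- exact: ge_Im.
Qed.

Lemma segment_ball z u v (d : R) (t : R) : 0 <= t <= 1 ->
  modulus (u - z) < d -> modulus (u + v - z) < d ->
  modulus (u + of_real t * v - z) < d.
Proof.
move=> /andP[t0 t1] ud vd.
have -> : u + of_real t * v - z = of_real (1 - t) * (u - z) + of_real t * (u + v - z).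
  by rewrite of_realB [of_real 1](_ : _ = 1) //; ring.
apply: le_lt_trans (modulusD _ _) _.
rewrite !modulusM !modulus_real !ger0_norm ?subr_ge0 //.
have [->|t0'] := eqVneq t 0; first by rewrite subr0 mul0r addr0 mul1r.
have tp : 0 < t by rewrite lt_def t0'.
have : t * modulus (u + v - z) < t * d by rewrite ltr_pM2l.
have : (1 - t) * modulus (u - z) <= (1 - t) * d.
  by rewrite ler_wpM2l ?subr_ge0 // ltW.
lra.
Qed.

End mean_value.

(** * The derivative of an analytic function is analytic *)

Section analytic_derivative.
Context {R : realType}.
Local Notation C := (Cplx R).
Implicit Types (H : C -> C) (z : C) (d r : R).

Definition unit_circle (t : R) : C := cexp (0 +i* t)%C.

Lemma modulus_unit_circle t : modulus (unit_circle t) = 1.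
Proof. by rewrite /unit_circle modulus_cexp /= expR0. Qed.

Lemma unit_circle_neq0 t : unit_circle t != 0.
Proof. exact: cexp_neq0. Qed.

Lemma unit_circle_continuous : continuous unit_circle.
Proof.
move=> t.
have : {for t, continuous ((@cexp R : C -> C) \o (fun x => (0 +i* x : C)%C))}.
  apply: continuous_comp; last exact: cexp_continuous.
  by apply: Complex_cvg; [exact: cvg_cst|exact: cvg_id].
exact.
Qed.

Lemma circle_continuous z r : continuous (fun t => z + of_real r * unit_circle t).
Proof.
move=> t; apply: (@cvgD _ _ _ (nbhs t)); first exact: cvg_cst.
by apply: (@cvgM _ _ (nbhs t)); [exact: cvg_cst|exact: unit_circle_continuous].
Qed.

Lemma unit_circleV_continuous : continuous (fun t => (unit_circle t)^-1).
Proof.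
move=> t; apply: (@cvgV _ _ (nbhs t)); first exact: unit_circle_neq0.
exact: unit_circle_continuous.
Qed.

(** On the vertical line of abscissa -1 the function [exp (- w)] is [e] times
    what it is on the imaginary axis, while the two integrals agree. *)
Lemma cint_unit_circleV : cint (fun t => (unit_circle t)^-1) 0 (pi *+ 2) = 0.
Proof.
pose h (w : C) := cexp (- w).
have dh w : derivable h w 1.
  have dl : derivable (fun w : C => - w) w 1 by apply: derivableN; exact: derivable_id.
  by have [] := @is_derive1C_comp _ (@cexp R) _ w _ _ (is_derive_cexp _) (derivableP dl).
have per w : h (w + (0 +i* (pi *+ 2))%C) = h w.
  by rewrite /h !cexpN cexpD cexp_2pi_i mulr1.
have N10 : -1 <= 0 :> R by lra.
have := vertical_cint_const N10 (fun w _ => dh w) per.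
have -> : cint (fun t => h (0 +i* t)%C) 0 (pi *+ 2) = cint (fun t => (unit_circle t)^-1) 0 (pi *+ 2).
  by apply: eq_cint => t _; rewrite /h cexpN.
have -> : cint (fun t => h (-1 +i* t)%C) 0 (pi *+ 2) =
    cint (fun t => cexp 1 * (unit_circle t)^-1) 0 (pi *+ 2).
  apply: eq_cint => t _; rewrite /h /unit_circle -cexpN -cexpD; congr cexp.
  by apply/eqP; rewrite eq_complex /= opprK oppr0 addr0 add0r !eqxx.
rewrite cintZ; last by move=> t _; exact: unit_circleV_continuous.
move/eqP; rewrite -subr_eq0 -[X in _ - X]mul1r -mulrBl mulf_eq0 => /orP[|/eqP//].
rewrite subr_eq0 => /eqP /(congr1 (@modulus R)).
rewrite modulus_cexp modulus1 => /eqP.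
by rewrite gt_eqF // -[ltLHS]expR0 ltr_expR.
Qed.

Definition deriv_ball H z d := forall w, modulus (w - z) < d -> derivable H w 1.

Lemma circle_in z r t : 0 <= r -> modulus (z + of_real r * unit_circle t - z) = r.
Proof.
move=> r0; rewrite addrC addKr modulusM modulus_unit_circle mulr1 modulus_real.
by rewrite ger0_norm.
Qed.

Lemma circle_cont H z d r : 0 <= r -> r < d -> deriv_ball H z d ->
  cont_itv (fun t => H (z + of_real r * unit_circle t)) 0 (pi *+ 2).
Proof.
move=> r0 rd dH t _.
have : {for t, continuous (H \o (fun t => z + of_real r * unit_circle t))}.
  apply: continuous_comp; first exact: circle_continuous.
  by apply: derivable_cont; apply: dH; rewrite circle_in.
exact.
Qed.

(** The remainder [H (z + r x) - H z - H' z r x] is [o(x)] at 0, so its Fourier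
    coefficient of index 1 vanishes. *)
Lemma cauchy_derivative H z d r : 0 < r -> r < d -> deriv_ball H z d ->
  cint (fun t => H (z + of_real r * unit_circle t) * (unit_circle t)^-1) 0 (pi *+ 2) =
  derive1 H z * of_real (r * (pi *+ 2)).
Proof.
move=> r0 rd dH.
have r0' : of_real r != 0 :> C by rewrite of_real_eq0 gt_eqF.
pose K (x : C) := H (z + of_real r * x) - (H z + derive1 H z * of_real r * x).
have dK x : modulus x < d / r -> derivable K x 1.
  move=> xd; apply: derivableB.
    have dl : derivable (fun x : C => z + of_real r * x) x 1.
      apply: derivableD; first exact: derivable_cst.
      by apply: derivableM; [exact: derivable_cst|exact: derivable_id].
    have dHx : derivable H (z + of_real r * x) 1.
      apply: dH; rewrite addrC addKr modulusM modulus_real ger0_norm ?(ltW r0) //.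
      by rewrite mulrC -ltr_pdivlMr.
    by have [] := @is_derive1C_comp _ H _ x _ _ (derivableP dHx) (derivableP dl).
  apply: derivableD; first exact: derivable_cst.
  by apply: derivableM; [exact: derivable_cst|exact: derivable_id].
have Ksmall : flat 1 K.
  move=> e e0; have er : 0 < e / r by rewrite divr_gt0.
  have /derivableP/is_derive_epsP/(_ _ er)[s s0 sP] : derivable H z 1.
    by apply: dH; rewrite subrr modulus0 (lt_trans r0).
  exists (s / r); first by rewrite divr_gt0.
  move=> x xs; rewrite expr1.
  have E : z + of_real r * x - z = of_real r * x by rewrite addrC addKr.
  have := sP (z + of_real r * x); rewrite E modulusM modulus_real ger0_norm ?(ltW r0) //.
  rewrite mulrC -ltr_pdivlMr // => /(_ xs).
  rewrite /K derive1E opprD addrA mulrA => h; apply: le_trans h _.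
  by apply: le_of_eq; field; lra.
have d1 : 1 < d / r by rewrite ltr_pdivlMr // mul1r.
have := circle_coef_eq0 d1 dK Ksmall.
pose f1 t := H (z + of_real r * unit_circle t) * (unit_circle t)^-1.
have -> : cint (fun t => K (cexp (0 +i* t)%C) * cexp (0 +i* t)%C ^- 1) 0 (pi *+ 2) =
    cint (fun t => f1 t - (H z * (unit_circle t)^-1 + derive1 H z * of_real r)) 0 (pi *+ 2).
  apply: eq_cint => t _; rewrite expr1 -/(unit_circle t) /K mulrBl; congr (_ - _).
  by rewrite mulrDl mulfK // unit_circle_neq0.
have c1 : cont_itv f1 0 (pi *+ 2).
  move=> t tI; apply: (@cvgM _ _ (nbhs t)); last exact: unit_circleV_continuous.
  exact: (circle_cont (ltW r0) rd dH).
have c2 : cont_itv (fun t => (unit_circle t)^-1 : C) 0 (pi *+ 2).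
  by move=> t tI; exact: unit_circleV_continuous.
have c3 : cont_itv (fun t => H z * (unit_circle t)^-1) 0 (pi *+ 2).
  by move=> t tI; apply: (@cvgM _ _ (nbhs t)); [exact: cvg_cst|exact: unit_circleV_continuous].
have c4 : cont_itv (fun t => derive1 H z * of_real r) 0 (pi *+ 2).
  by move=> t tI; exact: cvg_cst.
have c5 : cont_itv (fun t => H z * (unit_circle t)^-1 + derive1 H z * of_real r) 0 (pi *+ 2).
  by move=> t tI; apply: (@cvgD _ _ _ (nbhs t)); [exact: c3|exact: c4].
rewrite (cintB c1 c5) (cintD c3 c4) (cintZ _ c2) cint_unit_circleV mulr0 add0r.
have p0 : 0 <= pi *+ 2 :> R by rewrite mulrn_wge0 // pi_ge0.
rewrite (cint_cst _ p0) subr0 => /eqP.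
by rewrite subr_eq0 => /eqP ->; rewrite -mulrA -of_realM.
Qed.

(** The difference of Cauchy's formulas on two circles of equal radius. With [K]
    constant this is Cauchy's estimate; with [K = H] it makes [H'] Lipschitz. *)
Lemma cauchy_le H K z w d r (M : R) : 0 < r -> r < d ->
  deriv_ball H z d -> deriv_ball K w d ->
  (forall x, modulus x = r -> modulus (H (z + x) - K (w + x)) <= M) ->
  modulus (derive1 H z - derive1 K w) <= 2 * M / r.
Proof.
move=> r0 rd dH dK HM.
have p0 : 0 < pi *+ 2 :> R by rewrite mulrn_wgt0 // pi_gt0.
have rp0 : 0 < r * (pi *+ 2) by rewrite mulr_gt0.
have cf (L : C -> C) x : deriv_ball L x d ->
    cont_itv (fun t => L (x + of_real r * unit_circle t) * (unit_circle t)^-1) 0 (pi *+ 2).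
  move=> dL t tI; apply: (@cvgM _ _ (nbhs t)); last exact: unit_circleV_continuous.
  exact: (circle_cont (ltW r0) rd dL).
have eH := cauchy_derivative r0 rd dH.
have eK := cauchy_derivative r0 rd dK.
have cH := cf H z dH; have cK := cf K w dK.
have E : (derive1 H z - derive1 K w) * of_real (r * (pi *+ 2)) =
    cint (fun t => H (z + of_real r * unit_circle t) * (unit_circle t)^-1 -
                   K (w + of_real r * unit_circle t) * (unit_circle t)^-1) 0 (pi *+ 2).
  by rewrite (cintB cH cK) eH eK mulrBl.
have : modulus ((derive1 H z - derive1 K w) * of_real (r * (pi *+ 2))) <= 2 * M * (pi *+ 2 - 0).
  rewrite E; apply: le_cint; first exact: ltW.
    by move=> t tI; apply: (@cvgB _ _ _ (nbhs t)); [exact: cH|exact: cK].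
  move=> t _; rewrite -mulrBl modulusM modulusV modulus_unit_circle invr1 mulr1.
  apply: HM; rewrite modulusM modulus_real modulus_unit_circle mulr1.
  by rewrite ger0_norm // ltW.
rewrite subr0 modulusM modulus_real ger0_norm ?(ltW rp0) // => h.
rewrite -(ler_pM2r rp0); apply: le_trans h _.
by apply: le_of_eq; field; lra.
Qed.

Lemma deriv_ball_shrink H z w d d' : modulus (w - z) + d' <= d ->
  deriv_ball H z d -> deriv_ball H w d'.
Proof.
move=> wd dH x xw; apply: dH; apply: lt_le_trans wd.
rewrite (_ : x - z = (w - z) + (x - w)); last by ring.
by apply: le_lt_trans (modulusD _ _) _; rewrite ltrD2l.
Qed.

(** Near [z0], Cauchy's estimate bounds [H'], hence [H] is Lipschitz, hence by
    the estimate again [H'] is Lipschitz; so the difference quotients of [H]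
    converge uniformly on a circle and Cauchy's formula for [H'] can be
    differentiated under the integral sign. *)
Lemma derivable_derive1 H z0 d : 0 < d -> deriv_ball H z0 d ->
  derivable (derive1 H) z0 1.
Proof.
move=> d0 dH0.
have [d1 d10 H1] : exists2 d1 : R, 0 < d1 &
    forall w, modulus (w - z0) < d1 -> modulus (H w - H z0) < 1.
  have /derivable_cont/continuous_epsP : derivable H z0 1.
    by apply: dH0; rewrite subrr modulus0.
  exact.
have [D D0 [dH HB]] : exists2 D : R, 0 < D & deriv_ball H z0 D /\
    forall w, modulus (w - z0) < D -> modulus (H w - H z0) <= 1.
  exists (Num.min d d1); first by rewrite lt_min d0.
  by split=> w; rewrite lt_min => /andP[? ?]; [exact: dH0|exact/ltW/H1].
clear d1 d10 H1 dH0 d0 d.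
have p0 : 0 < pi *+ 2 :> R by rewrite mulrn_wgt0 // pi_gt0.
have add_ball z x a b : modulus (z - z0) < a -> modulus x <= b -> modulus (z + x - z0) < a + b.
  by move=> za xb; rewrite addrAC (le_lt_trans (modulusD _ _)) // ltr_leD.
(* Cauchy's estimate on discs of radius [r] bounds [H'] by [2 / r]. *)
set r := D / 4; have r0 : 0 < r by rewrite divr_gt0.
have shrink z : modulus (z - z0) < D / 2 -> deriv_ball H z (D / 2).
  by move=> zD; apply: deriv_ball_shrink dH; lra.
have B1 z : modulus (z - z0) < D / 2 -> modulus (derive1 H z) <= 2 / r.
  move=> zD.
  have := @cauchy_le H (cst (H z0)) z z (D / 2) r 1 r0.
  rewrite derive1_cst subr0 mulr1; apply; rewrite /r; first by lra.
  - exact: shrink.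
  - by move=> w _; exact: derivable_cst.
  - move=> x xr; apply: HB; apply: lt_le_trans (add_ball _ _ _ (D / 4) zD _) _; last lra.
    by rewrite xr.
set L1 := 2 * (2 / r).
have L10 : 0 <= L1 by rewrite /L1 mulr_ge0 // divr_ge0 // ltW.
have Lip z w : modulus (z - z0) < D / 2 -> modulus (w - z0) < D / 2 ->
    modulus (H z - H w) <= L1 * modulus (z - w).
  move=> zD wD; have zw : z = w + (z - w) by rewrite addrC subrK.
  have seg t : 0 <= t <= 1 -> modulus (w + of_real t * (z - w) - z0) < D / 2.
    by move=> t01; apply: segment_ball => //; rewrite -zw.
  rewrite {1}zw; apply: mean_value_le => t /seg tD; last exact: B1.
  by apply: dH; lra.
(* The same estimate for two points makes [H'] Lipschitz. *)
set L2 := 2 * L1 / r.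
have L20 : 0 <= L2 by apply: divr_ge0; [exact: mulr_ge0|exact: ltW].
have Lip' z w : modulus (z - z0) < D / 4 -> modulus (w - z0) < D / 4 ->
    modulus (derive1 H z - derive1 H w) <= L2 * modulus (z - w).
  move=> zD wD.
  have := @cauchy_le H H z w (D / 2) r (L1 * modulus (z - w)) r0.
  rewrite (_ : 2 * (L1 * modulus (z - w)) / r = L2 * modulus (z - w)); last by rewrite /L2; field; lra.
  apply; rewrite /r; first by lra.
  - by apply: shrink; lra.
  - by apply: shrink; lra.
  - move=> x xr; rewrite (_ : z - w = (z + x) - (w + x)); last by rewrite opprD addrACA subrr addr0.
    have D24 : D / 2 = D / 4 + D / 4 by field.
    by apply: Lip; rewrite D24; apply: add_ball => //; rewrite xr.
(* Taylor's formula of order 1, uniformly in the base point. *)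
have second u k : modulus (u - z0) < D / 4 -> modulus (u + k - z0) < D / 4 ->
    modulus (H (u + k) - H u - k * derive1 H u) <= 2 * L2 * modulus k ^+ 2.
  move=> uD ukD.
  pose G x := H x - derive1 H u * x.
  have dG x : modulus (x - z0) < D / 4 -> is_derive x 1 G (derive1 H x - derive1 H u).
    move=> xD; rewrite derive1E.
    have dHx : derivable H x 1 by apply: dH; lra.
    have h := is_deriveB (derivableP dHx) (is_deriveZ (derive1 H u) (is_derive_id x (1 : C))).
    by apply: (is_derive_eq h); rewrite /GRing.scale /= mulr1.
  have seg t : 0 <= t <= 1 -> modulus (u + of_real t * k - z0) < D / 4.
    by move=> t01; apply: segment_ball.
  rewrite (_ : _ - _ = G (u + k) - G u); last by rewrite /G; ring.
  rewrite expr2 [2 * L2 * _]mulrA -[2 * L2 * _]mulrA.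
  apply: mean_value_le => t t01; have tD := seg t t01; have [dGt eG] := dG _ tD => //.
  rewrite derive1E eG.
  apply: le_trans (Lip' _ _ tD uD) _; rewrite addrC addKr modulusM modulus_real.
  rewrite ler_wpM2l // ger0_norm; last by case/andP: t01.
  by rewrite ler_piMl ?modulus_ge0 //; case/andP: t01.
set s := D / 8; have s0 : 0 < s by rewrite divr_gt0.
have circ t : modulus (z0 + of_real s * unit_circle t - z0) < D / 4.
  by rewrite circle_in ?ltW // /s; lra.
have sp0 : 0 < s * (pi *+ 2) by rewrite mulr_gt0.
set c : C := of_real (s * (pi *+ 2)).
have c0 : c != 0 by rewrite of_real_eq0 gt_eqF.
pose dF t := derive1 H (z0 + of_real s * unit_circle t) * (unit_circle t)^-1.
pose F z t := H (z + of_real s * unit_circle t) * (unit_circle t)^-1.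
have cdF : cont_itv dF 0 (pi *+ 2).
  move=> t tI; apply: (@cvgM _ _ (nbhs t)); last exact: unit_circleV_continuous.
  have : {for t, continuous (derive1 H \o (fun t => z0 + of_real s * unit_circle t))}.
    apply: continuous_comp; first exact: circle_continuous.
    apply/continuous_epsP => e e0.
    have eL : 0 < e / (L2 + 1) by rewrite divr_gt0 // ltr_wpDl.
    have gap : 0 < D / 4 - s by rewrite /s; lra.
    exists (Num.min (e / (L2 + 1)) (D / 4 - s)); first by rewrite lt_min eL.
    move=> w; rewrite lt_min => /andP[w1 w2].
    have wD : modulus (w - z0) < D / 4.
      rewrite (_ : w - z0 = (w - (z0 + of_real s * unit_circle t)) +
        (z0 + of_real s * unit_circle t - z0)); last by ring.
      apply: le_lt_trans (modulusD _ _) _; rewrite circle_in ?(ltW s0) //; lra.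
    apply: le_lt_trans (Lip' _ _ wD (circ t)) _.
    rewrite ltr_pdivlMr ?ltr_wpDl // in w1.
    apply: le_lt_trans w1; rewrite mulrC ler_wpM2l ?modulus_ge0 //; lra.
  exact.
have cF z : modulus (z - z0) < D / 8 -> cont_itv (F z) 0 (pi *+ 2).
  move=> zD t tI; apply: (@cvgM _ _ (nbhs t)); last exact: unit_circleV_continuous.
  by apply: (circle_cont (d := D / 2) (ltW s0)) tI; [rewrite /s; lra|apply: shrink; lra].
have formula z : modulus (z - z0) < D / 8 -> cint (F z) 0 (pi *+ 2) = derive1 H z * c.
  by move=> zD; apply: (@cauchy_derivative _ _ (D / 2)) => //; [rewrite /s; lra|apply: shrink; lra].
(* The derivative of [H'] at [z0], read off Cauchy's formula. *)
set A := cint dF 0 (pi *+ 2) / c.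
suff : is_derive z0 1 (derive1 H) A by case.
apply/is_derive_epsP => e e0.
set M := 4 * L2 / s.
have M0 : 0 <= M by apply: divr_ge0; [exact: mulr_ge0|exact: ltW].
have eM : 0 < e / (M + 1) by rewrite divr_gt0 // ltr_wpDl.
exists (Num.min s (e / (M + 1))); first by rewrite lt_min s0.
move=> z; rewrite lt_min => /andP[zs ze].
set k := z - z0 in zs ze *.
have z0s : modulus (z0 - z0) < D / 8 by rewrite subrr modulus0.
have ck : cont_itv (fun t => k * dF t) 0 (pi *+ 2).
  by move=> t tI; apply: (@cvgM _ _ (nbhs t)); [exact: cvg_cst|exact: cdF].
have cFF : cont_itv (fun t => F z t - F z0 t) 0 (pi *+ 2).
  by move=> t tI; apply: (@cvgB _ _ _ (nbhs t)); exact: cF.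
have E : (derive1 H z - derive1 H z0 - A * k) * c =
    cint (fun t => F z t - F z0 t - k * dF t) 0 (pi *+ 2).
  rewrite (cintB cFF ck) (cintB (cF _ zs) (cF _ z0s)) (cintZ _ cdF).
  rewrite !formula // [LHS]mulrBl [X in X - _ = _]mulrBl; congr (_ - _).
  by rewrite /A mulrAC divfK // mulrC.
have : modulus ((derive1 H z - derive1 H z0 - A * k) * c) <=
    2 * (2 * L2 * modulus k ^+ 2) * (pi *+ 2 - 0).
  rewrite E; apply: le_cint; first exact: ltW.
    by move=> t tI; apply: (@cvgB _ _ _ (nbhs t)); [exact: cFF|exact: ck].
  move=> t _; rewrite /F /dF mulrA -!mulrBl modulusM modulusV modulus_unit_circle invr1 mulr1.
  rewrite (_ : z = z0 + k); last by rewrite /k addrC subrK.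
  rewrite [z0 + k + _]addrAC; apply: second; first exact: circ.
  have D84 : D / 4 = D / 8 + D / 8 by field.
  rewrite [z0 + _ + k]addrAC D84.
  apply: add_ball; first by rewrite [z0 + k]addrC addrK.
  by rewrite modulusM modulus_real modulus_unit_circle mulr1 ger0_norm // ltW.
rewrite subr0 modulusM modulus_real ger0_norm ?(ltW sp0) // => h.
have {}h : modulus (derive1 H z - derive1 H z0 - A * k) <= M * modulus k * modulus k.
  rewrite -(ler_pM2r sp0); apply: le_trans h _.
  by apply: le_of_eq; rewrite /M; field; lra.
apply: le_trans h _; rewrite ler_wpM2r ?modulus_ge0 //.
rewrite ltr_pdivlMr ?ltr_wpDl // in ze.
apply: le_trans (ltW ze); rewrite mulrC ler_wpM2l ?modulus_ge0 //; lra.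
Qed.

End analytic_derivative.

(** * Jets *)

Section jets.
Context {R : realType}.
Local Notation C := (Cplx R).
Implicit Types (f g H : C -> C) (z : C) (d : R) (p q : {poly C}).

Lemma flat_near n f g : (exists2 d : R, 0 < d & forall z, modulus z < d -> f z = g z) ->
  flat n f -> flat n g.
Proof.
move=> [d d0 fg] lf e e0; have [d' d'0 H] := lf e e0.
exists (Num.min d d'); first by rewrite lt_min d0.
by move=> z; rewrite lt_min => /andP[/fg <- /H].
Qed.

Lemma flatD n f g : flat n f -> flat n g -> flat n (fun z => f z + g z).
Proof.
move=> lf lg e e0; have e20 : 0 < e / 2 by rewrite divr_gt0.
have [d1 d10 H1] := lf _ e20; have [d2 d20 H2] := lg _ e20.
exists (Num.min d1 d2); first by rewrite lt_min d10.
move=> z; rewrite lt_min => /andP[/H1 h1 /H2 h2].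
apply: le_trans (modulusD _ _) _; apply: le_trans (lerD h1 h2) _.
by apply: le_of_eq; field.
Qed.

Lemma flatM n f g : (exists M : R, exists2 d : R, 0 < d &
    forall z, modulus z < d -> modulus (g z) <= M) ->
  flat n f -> flat n (fun z => g z * f z).
Proof.
move=> [M [d d0 gM]] lf e e0.
have M0 : 0 <= M by apply: le_trans (gM 0 _); rewrite ?modulus_ge0 // modulus0.
have eM : 0 < e / (M + 1) by rewrite divr_gt0 // ltr_wpDl.
have [d1 d10 H1] := lf _ eM.
exists (Num.min d d1); first by rewrite lt_min d0.
move=> z; rewrite lt_min => /andP[/gM h1 /H1 h2].
rewrite modulusM; apply: le_trans (ler_pM (modulus_ge0 _) (modulus_ge0 _) h1 h2) _.
have m0 : 0 <= modulus z ^+ n by rewrite exprn_ge0 // modulus_ge0.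
rewrite mulrA ler_wpM2r // mulrCA ler_piMr ?(ltW e0) //.
by rewrite ler_pdivrMr ?ltr_wpDl // mul1r lerDl.
Qed.

Lemma cont_locally_bounded f : {for 0, continuous f} ->
  exists M : R, exists2 d : R, 0 < d & forall z, modulus z < d -> modulus (f z) <= M.
Proof.
move=> /continuous_epsP/(_ 1 ltr01)[d d0 dP].
exists (modulus (f 0) + 1), d => // z; rewrite -{1}(subr0 z) => /dP h.
rewrite -(subrK (f 0) (f z)); apply: le_trans (modulusD _ _) _.
by rewrite addrC lerD2l ltW.
Qed.

Lemma flatN n f : flat n f -> flat n (fun z => - f z).
Proof. by move=> lf e /lf[d d0 H]; exists d => // z /H; rewrite modulusN. Qed.

Lemma flatB n f g : flat n f -> flat n g -> flat n (fun z => f z - g z).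
Proof. by move=> lf lg; apply: flatD => //; exact: flatN. Qed.

Lemma flat_le m n f : (m <= n)%N -> flat n f -> flat m f.
Proof.
move=> mn lf e e0; have [d d0 H] := lf e e0.
exists (Num.min 1 d); first by rewrite lt_min ltr01.
move=> z; rewrite lt_min => /andP[z1 /H h]; apply: le_trans h _.
rewrite ler_wpM2l ?(ltW e0) //; apply: ler_wiXn2l => //; first exact: modulus_ge0.
exact: ltW.
Qed.

Lemma flat_at0 n f : flat n f -> f 0 = 0.
Proof.
move=> /(flat_le (leq0n n)) lf; apply/eqP; rewrite -modulus_eq0 eq_le modulus_ge0 andbT.
apply/ler_addgt0Pl => e e0; rewrite addr0; have [d d0 H] := lf e e0.
by have := H 0; rewrite modulus0 expr0 mulr1; exact.
Qed.

(** Integration along the segment from 0 to [z] gains one power of [|z|]. *)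
Lemma flat_primitive n H d : 0 < d -> deriv_ball H 0 d -> H 0 = 0 ->
  flat n (derive1 H) -> flat n.+1 H.
Proof.
move=> d0 dH H0 lH e e0; have e20 : 0 < e / 2 by rewrite divr_gt0.
have [d1 d10 H1] := lH _ e20.
exists (Num.min d d1); first by rewrite lt_min d0.
move=> z; rewrite lt_min => /andP[zd zd1].
have tz t : 0 <= t <= 1 -> modulus (0 + of_real t * z) <= modulus z.
  move=> /andP[t0 t1]; rewrite add0r modulusM modulus_real ger0_norm //.
  by rewrite ler_piMl // modulus_ge0.
have := @mean_value_le _ H 0 z (e / 2 * modulus z ^+ n).
rewrite add0r H0 subr0 => h; apply: le_trans (h _ _) _.
- by move=> t /tz h'; apply: dH; rewrite subr0 (le_lt_trans h').
- move=> t /tz h'; apply: le_trans (H1 _ (le_lt_trans h' zd1)) _.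
  by rewrite ler_wpM2l ?(ltW e20) // lerXn2r // nnegrE modulus_ge0.
- by apply: le_of_eq; rewrite exprSr; field.
Qed.

Lemma deriv_ball_derive1 H d : deriv_ball H 0 d -> deriv_ball (derive1 H) 0 d.
Proof.
move=> dH w; rewrite subr0 => wd; apply: (@derivable_derive1 _ _ _ (d - modulus w)).
  by rewrite subr_gt0.
by apply: deriv_ball_shrink dH; rewrite subr0 addrC subrK.
Qed.

(** Cauchy's estimate on the circle of radius [|z|] about [z]. *)
Lemma flat_derive1 n H d : 0 < d -> deriv_ball H 0 d -> flat n.+1 H -> flat n (derive1 H).
Proof.
move=> d0 dH lH e e0.
(* [2 ^ (n + 1)] pays for [|z + x| <= 2 |z|] and the last 2 for the estimate. *)
have e'0 : 0 < e / (2 ^+ n.+2) by rewrite divr_gt0 // exprn_gt0.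
have [d1 d10 H1] := lH _ e'0.
have dH0 : derive1 H 0 = 0.
  have : is_derive (0 : C) 1 H 0.
    apply/is_derive_epsP => e1 e10; have [d2 d20 H2] := flat_le (isT : (1 <= n.+1)%N) lH e10.
    by exists d2 => // w; rewrite subr0 mul0r subr0 (flat_at0 lH) subr0 => /H2.
  by case=> _; rewrite derive1E.
exists (Num.min (d / 4) (d1 / 4)); first by rewrite lt_min !divr_gt0.
move=> z; rewrite lt_min => /andP[zd zd1].
have [->|z0] := eqVneq z 0.
  by rewrite dH0 !modulus0 mulr_ge0 ?(ltW e0) // exprn_ge0.
have mz : 0 < modulus z by rewrite modulus_gt0.
have := @cauchy_le _ H (cst 0) z z (2 * modulus z) (modulus z)
  (e / (2 ^+ n.+2) * (2 * modulus z) ^+ n.+1) mz.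
rewrite derive1_cst subr0 => h; apply: le_trans (h _ _ _ _) _; first lra.
- by apply: deriv_ball_shrink dH; rewrite subr0; lra.
- by move=> w _; exact: derivable_cst.
- move=> x xz; have zx : modulus (z + x) <= 2 * modulus z.
    by apply: le_trans (modulusD _ _) _; rewrite xz; lra.
  rewrite /cst subr0; apply: le_trans (H1 _ _) _; first lra.
  rewrite ler_wpM2l ?(ltW e'0) // lerXn2r // nnegrE ?modulus_ge0 //; lra.
- apply: le_of_eq; rewrite exprMn !exprS; field.
  by rewrite lt0r_neq0 // expf_neq0.
Qed.

Lemma is_derive_horner p z : is_derive z 1 (horner p) (p^`()).[z].
Proof.
elim/poly_ind: p => [|p c IH].
  rewrite deriv0 horner0 (_ : horner 0 = cst 0); first exact: is_derive_cst.
  by apply/funext => w; rewrite horner0.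
have -> : horner (p * 'X + c%:P) = (fun w => p.[w] * w + c).
  by apply/funext => w; rewrite !hornerE.
have h := is_deriveD (is_deriveM IH (is_derive_id z (1 : C))) (is_derive_cst c z (1 : C)).
apply: (is_derive_eq h).
rewrite derivD derivC derivM derivX mulr1 !hornerE /GRing.scale /=; ring.
Qed.

Lemma derivable_hornerC p z : derivable (horner p) z 1.
Proof. by have [] := is_derive_horner p z. Qed.

Lemma derive1_hornerC p : derive1 (horner p) = horner p^`().
Proof. by apply/funext => z; rewrite derive1E; have [_ ->] := is_derive_horner p z. Qed.

Lemma deriv_eq0_const p : p^`() = 0 -> p.[0] = 0 -> p = 0.
Proof.
move=> dp p0; apply/polyP => -[|i]; first by rewrite -horner_coef0 p0 coef0.
have := congr1 (fun q : {poly C} => q`_i) dp.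
rewrite coef_deriv !coef0 => /eqP; rewrite mulrn_eq0 /= => /eqP //.
Qed.

(** Differentiating lowers both the degree and the order of flatness by one, so
    that induction applies. *)
Lemma poly_flat_eq0 n p : (size p <= n.+1)%N -> flat n (horner p) -> p = 0.
Proof.
elim: n p => [|n IH] p sp lp; apply: deriv_eq0_const; try exact: (flat_at0 lp).
  by rewrite (size1_polyC sp) derivC.
apply: IH.
  have [->|p0] := eqVneq p 0; first by rewrite deriv0 size_poly0.
  by rewrite -ltnS; apply: leq_trans (lt_size_deriv p0) sp.
rewrite -derive1_hornerC; apply: flat_derive1 lp; first exact: ltr01.
by move=> w _; exact: derivable_hornerC.
Qed.

Definition jet n H : 'I_n.+1 -> C := fun j => derive1n j H 0.

Lemma deriv_taylor_jet n H :
  (taylor_poly (@jet n.+1 H))^`() = taylor_poly (@jet n (derive1 H)).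
Proof.
rewrite /taylor_poly big_ord_recl derivD derivZ derivXn /= mulr0n scaler0 add0r.
rewrite raddf_sum; apply: eq_bigr => j _ /=.
rewrite derivZ derivXn /= /bump /= add1n /= -[in LHS](scaler_nat j.+1) scalerA; congr (_ *: _).
rewrite /jet lift0 derive1Sn factS natrM [_.+1%:R * _]mulrC invfM mulrA divfK //.
Qed.

Lemma size_taylor_poly n (c : 'I_n.+1 -> C) : (size (taylor_poly c) <= n.+1)%N.
Proof.
rewrite /taylor_poly; apply: (leq_trans (size_sum _ _ _)); apply/bigmax_leqP => i _.
by apply: (leq_trans (size_scale_leq _ _)); rewrite size_polyXn.
Qed.

Lemma coef_taylor_poly n (c : 'I_n.+1 -> C) (j : 'I_n.+1) :
  (taylor_poly c)`_j = c j / (j`!)%:R.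
Proof.
rewrite /taylor_poly coef_sum (bigD1 j) //= coefZ coefXn eqxx mulr1 big1 ?addr0 //.
by move=> i ij; rewrite coefZ coefXn eq_sym (inj_eq val_inj) (negbTE ij) mulr0.
Qed.

Lemma taylor_poly_at0 n (c : 'I_n.+1 -> C) : (taylor_poly c).[0] = c ord0.
Proof.
by rewrite horner_coef0 -[0%N]/(nat_of_ord (ord0 : 'I_n.+1)) coef_taylor_poly fact0 divr1.
Qed.

(** Taylor's formula with Peano's remainder, by induction: the Taylor polynomial
    of [H'] is the derivative of that of [H]. *)
Lemma taylor_flat n H d : 0 < d -> deriv_ball H 0 d ->
  flat n (fun z => H z - (taylor_poly (@jet n H)).[z]).
Proof.
move=> d0; elim: n H => [|n IH] H dH.
  have cH : {for 0, continuous H} by apply: derivable_cont; apply: dH; rewrite subrr modulus0.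
  move=> e e0; have [d1 d10 H1] := (continuous_epsP _ _).1 cH _ e0.
  exists d1 => // z; rewrite -{1}(subr0 z) => /H1; rewrite expr0 mulr1.
  rewrite /taylor_poly big_ord1 expr0 hornerZ hornerC mulr1 fact0 divr1 /jet /=.
  exact: ltW.
have dK (w : C) : modulus (w - 0) < d -> is_derive w 1
    (fun z => H z - (taylor_poly (@jet n.+1 H)).[z])
    (derive1 H w - (taylor_poly (@jet n (derive1 H))).[w]).
  move=> /dH/derivableP dHw; rewrite derive1E -deriv_taylor_jet.
  exact: is_deriveB dHw (is_derive_horner _ w).
apply: (flat_primitive d0).
- by move=> w /dK[].
- by rewrite taylor_poly_at0 /jet /= subrr.
- apply: flat_near (IH _ (deriv_ball_derive1 dH)); exists d => // z zd.
  by rewrite [RHS]derive1E; have [|_ ->//] := dK z; rewrite subr0.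
Qed.

(** This is how jets are computed below: having a prescribed jet means agreeing
    with a polynomial up to [o(z ^ n)], a relation that is compatible with powers
    and needs no formula for higher derivatives. *)
Lemma has_jet_flat n H d (c : 'I_n.+1 -> C) : 0 < d -> deriv_ball H 0 d ->
  has_jet c H <-> flat n (fun z => H z - (taylor_poly c).[z]).
Proof.
move=> d0 dH; have lH := taylor_flat n d0 dH.
split.
  move=> Hc; rewrite (_ : c = @jet n H) //.
  by apply/funext => j; rewrite /jet Hc.
move=> lc; have E : taylor_poly (@jet n H) - taylor_poly c = 0.
  apply: (@poly_flat_eq0 n).
    apply: leq_trans (size_polyD _ _) _; rewrite size_polyN geq_max.
    by rewrite !size_taylor_poly.
  apply: flat_near (flatB lc lH); exists 1 => // z _.
  by rewrite hornerD hornerN; ring.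
move=> j; have /eqP := congr1 (fun q : {poly C} => q`_j) E.
rewrite coefB coef0 !coef_taylor_poly subr_eq0 => /eqP.
apply: mulIf; rewrite invr_eq0 pnatr_eq0 -lt0n fact_gt0 //.
Qed.

End jets.

(** * Logarithms of polynomials *)

Section powers.
Context {R : realType}.
Local Notation C := (Cplx R).
Implicit Types (f g L : C -> C) (z : C) (d t : R) (p : {poly C}).

Lemma derivable_near_eq f g z : (exists2 d : R, 0 < d &
    forall w, modulus (w - z) < d -> f w = g w) ->
  derivable f z 1 -> derivable g z 1.
Proof.
move=> [d d0 fg] /derivableP df; have fz : f z = g z by apply: fg; rewrite subrr modulus0.
suff : is_derive z 1 g ('D_1 f z) by case.
apply/is_derive_epsP => e e0; have [d' d'0 H] := (is_derive_epsP _ _ _).1 df e e0.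
exists (Num.min d d'); first by rewrite lt_min d0.
by move=> w; rewrite lt_min => /andP[/fg <- /H]; rewrite -fz.
Qed.

Lemma unit_disc_ball z : unit_disc z -> exists2 d : R, 0 < d &
  forall w, modulus (w - z) < d -> unit_disc w.
Proof.
move=> z1; exists (1 - modulus z); first by rewrite subr_gt0.
move=> w wz; rewrite /unit_disc /= -(subrK z w).
by apply: le_lt_trans (modulusD _ _) _; rewrite addrC -ltrBrDl.
Qed.

Lemma analytic_eq f g : (forall z, unit_disc z -> f z = g z) ->
  analytic_on unit_disc f -> analytic_on unit_disc g.
Proof.
move=> fg df z zD; apply: derivable_near_eq (df z zD).
by have [d d0 dD] := unit_disc_ball zD; exists d => // w /dD /fg.
Qed.

Lemma analytic_deriv_ball f : analytic_on unit_disc f -> deriv_ball f 0 1.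
Proof. by move=> df w; rewrite subr0; exact: df. Qed.

Lemma derivable_cexpZ t L z : derivable L z 1 ->
  derivable (fun w => cexp (of_real t * L w)) z 1.
Proof.
move=> dL.
have dtL : derivable (fun w => of_real t * L w) z 1.
  by apply: derivableM; [exact: derivable_cst|exact: dL].
by have [] := @is_derive1C_comp _ (@cexp R) _ z _ _ (is_derive_cexp _) (derivableP dtL).
Qed.

Lemma cexp_sub1_le : exists2 d : R, 0 < d & forall k : C, modulus k < d ->
  modulus (cexp k - 1) <= 2 * modulus k.
Proof.
have [d d0 H] := (is_derive_epsP _ _ _).1 (@is_derive_cexp0 R) _ ltr01.
exists d => // k kd; have := H k; rewrite subr0 mul1r cexp0 => /(_ kd) {}H.
rewrite -(subrK k (cexp k - 1)); apply: le_trans (modulusD _ _) _; lra.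
Qed.

Lemma cont_small f : {for 0, continuous f} -> f 0 = 0 -> forall e : R, 0 < e ->
  exists2 d : R, 0 < d & forall z, modulus z < d -> modulus (f z) < e.
Proof.
move=> /continuous_epsP cf f0 e /cf[d d0 H]; exists d => // z.
by rewrite -{1}(subr0 z) => /H; rewrite f0 subr0.
Qed.

(** Both [exp f - 1] and [exp (t f) - 1] are comparable to [f]. *)
Lemma flat_cexp_sub1 n t f : {for 0, continuous f} -> f 0 = 0 ->
  flat n (fun z => cexp (f z) - 1) -> flat n (fun z => cexp (of_real t * f z) - 1).
Proof.
move=> cf f0 lf e e0.
have [d1 d10 H1] := @cexp_sub1_ge R; have [d2 d20 H2] := cexp_sub1_le.
have T0 : 0 < `|t| + 1 by rewrite ltr_wpDl.
have e'0 : 0 < e / (4 * (`|t| + 1)) by rewrite divr_gt0 // mulr_gt0.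
have [d3 d30 H3] := lf _ e'0.
have [d4 d40 H4] := cont_small cf f0 d10.
have [d5 d50 H5] := cont_small cf f0 (divr_gt0 d20 T0).
exists (Num.min d3 (Num.min d4 d5)); first by rewrite !lt_min d30 d40.
move=> z; rewrite !lt_min => /andP[z3 /andP[z4 z5]].
have tf : modulus (of_real t * f z) <= (`|t| + 1) * modulus (f z).
  by rewrite modulusM modulus_real ler_wpM2r ?modulus_ge0 // lerDl.
apply: le_trans (H2 _ _) _.
  by apply: le_lt_trans tf _; rewrite mulrC -ltr_pdivlMr //; exact: H5.
have h1 := H1 _ (H4 _ z4); have h3 := H3 _ z3.
have m0 := modulus_ge0 (f z).
set E := e / (4 * (`|t| + 1)) in h3.
have h : 2 * modulus (of_real t * f z) <= 2 * ((`|t| + 1) * (2 * (E * modulus z ^+ n))).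
  rewrite ler_pM2l //; apply: le_trans tf _; rewrite ler_pM2l //.
  by apply: le_trans h1 _; rewrite ler_pM2l.
by apply: le_trans h _; apply: le_of_eq; rewrite /E; field; rewrite gt_eqF.
Qed.

Lemma poly_roots_factor p : p.[0] != 0 -> exists rs : seq C,
  (forall a, mup a p = count_mem a rs) /\
  (forall z, p.[z] = p.[0] * \prod_(a <- rs) (1 - z / a)) /\
  (forall a, a \in rs -> root p a /\ a != 0).
Proof.
move=> p0.
have pn0 : p != 0 by apply: contraNneq p0 => ->; rewrite horner0.
have [rs E] := @closed_field_poly_normal R[i] p.
have {}E : p = lead_coef p *: \prod_(a <- rs) ('X - a%:P) by exact: E.
have l0 : lead_coef p != 0 by rewrite lead_coef_eq0.
exists rs; split; last split.
- move=> a; rewrite {1}E -mul_polyC mupMr ?rootC //.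
  elim: rs {E} => [|b rs IH]; first by rewrite big_nil /= mupNroot // root1.
  rewrite big_cons mupM ?polyXsubC_eq0 ?monic_neq0 ?monic_prod_XsubC //.
  by rewrite IH /= -(expr1 ('X - b%:P)) mup_XsubCX eq_sym; case: eqP.
- have rs0 : all (fun a => a != 0) rs.
    apply/allP => a ars; apply: contraNneq p0 => a0.
    rewrite E hornerZ horner_prod mulf_eq0 prodf_seq_eq0; apply/orP; right.
    by apply/hasP; exists a => //=; rewrite hornerXsubC a0 subrr.
  move=> z; rewrite {1 2}E !hornerZ !horner_prod -mulrA -big_split /=; congr (_ * _).
  rewrite !big_seq; apply: eq_bigr => a /(allP rs0) a0.
  by rewrite !hornerE; field.
- move=> a ars; have ra : root p a.
    by rewrite E rootZ // root_prod_XsubC.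
  by split => //; apply: contraNneq p0 => a0; move: ra; rewrite a0 rootE.
Qed.

Lemma derivable_sub_div (a : C) z : derivable (fun w : C => 1 - w / a) z 1.
Proof.
apply: derivableB; first exact: derivable_cst.
by apply: derivableM; [exact: derivable_id|exact: derivable_cst].
Qed.

Lemma Re_sub_div_gt0 (a z : C) : 1 <= modulus a -> modulus z < 1 -> 0 < complex.Re (1 - z / a).
Proof.
move=> a1 z1; have a0 : 0 < modulus a by apply: lt_le_trans a1.
have : `|complex.Re (z / a)| < 1.
  apply: le_lt_trans (ge_Re _) _; rewrite modulusM modulusV ltr_pdivrMr // mul1r.
  exact: lt_le_trans a1.
rewrite ltr_norml => /andP[_ h].
by case: (z / a) h => x y /= h; rewrite subr_gt0.
Qed.

Lemma derivable_Log_sub_div (a z : C) : 1 <= modulus a -> modulus z < 1 ->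
  derivable (fun w : C => Log (1 - w / a)) z 1.
Proof.
move=> a1 z1.
by have [] := @is_derive1C_comp _ (@Log R) _ z _ _ (is_derive_Log (Re_sub_div_gt0 a1 z1))
  (derivableP (@derivable_sub_div a z)).
Qed.

Lemma derivable_sum_seq (T : eqType) (s : seq T) (F : T -> C -> C) z :
  (forall a, a \in s -> derivable (F a) z 1) ->
  derivable (fun w => \sum_(a <- s) F a w) z 1.
Proof.
elim: s => [_|a s IH dF].
  rewrite (_ : (fun _ => _) = cst 0); first exact: derivable_cst.
  by apply/funext => w; rewrite big_nil.
rewrite (_ : (fun _ => _) = (fun w => F a w + \sum_(b <- s) F b w)).
  apply: derivableD; first by apply: dF; rewrite mem_head.
  by apply: IH => b bs; apply: dF; rewrite in_cons bs orbT.
by apply/funext => w; rewrite big_cons.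
Qed.

Lemma derivable_prod_seq (T : eqType) (s : seq T) (F : T -> C -> C) z :
  (forall a, a \in s -> derivable (F a) z 1) ->
  derivable (fun w => \prod_(a <- s) F a w) z 1.
Proof.
elim: s => [_|a s IH dF].
  rewrite (_ : (fun _ => _) = cst 1); first exact: derivable_cst.
  by apply/funext => w; rewrite big_nil.
rewrite (_ : (fun _ => _) = (fun w => F a w * \prod_(b <- s) F b w)).
  apply: derivableM; first by apply: dF; rewrite mem_head.
  by apply: IH => b bs; apply: dF; rewrite in_cons bs orbT.
by apply/funext => w; rewrite big_cons.
Qed.

Lemma cexp_sum (T : Type) (s : seq T) (F : T -> C) :
  cexp (\sum_(a <- s) F a) = \prod_(a <- s) cexp (F a).
Proof.
by elim: s => [|a s IH]; rewrite ?big_nil ?cexp0 // !big_cons cexpD IH.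
Qed.

Lemma Log_sub_div0 (a : C) : Log (1 - 0 / a) = 0.
Proof. by rewrite mul0r subr0 Log1. Qed.

(** For [|z| < 1 <= |a|] the factor [1 - z / a] lies in the right half-plane,
    where the principal logarithm is analytic. *)
Lemma poly_disc_log p (w : C) : p.[0] = cexp w -> (forall z, unit_disc z -> p.[z] != 0) ->
  exists L, [/\ analytic_on unit_disc L, L 0 = w & forall z, unit_disc z -> cexp (L z) = p.[z]].
Proof.
move=> p0 pn0; have p00 : p.[0] != 0 by rewrite p0 cexp_neq0.
have [rs [_ [pE rsP]]] := poly_roots_factor p00.
have rs1 a : a \in rs -> 1 <= modulus a.
  move=> /rsP[/rootP ra _]; rewrite leNgt; apply/negP => /(pn0 a).
  by rewrite ra eqxx.
exists (fun z => w + \sum_(a <- rs) Log (1 - z / a)); split.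
- move=> z zD; apply: derivableD; first exact: derivable_cst.
  by apply: derivable_sum_seq => a /rs1 a1; exact: derivable_Log_sub_div.
- by rewrite big1 ?addr0 // => a _; rewrite Log_sub_div0.
- move=> z zD; rewrite cexpD cexp_sum [RHS]pE p0; congr (_ * _).
  rewrite !big_seq; apply: eq_bigr => a /rs1 a1; apply: cexp_Log.
  exact: Re_sub_div_gt0.
Qed.

Lemma open_ball0 d : 0 < d -> open_nbhs (0 : C) [set z : C | modulus z < d].
Proof.
move=> d0; split; last by rewrite /= modulus0.
have -> : [set z : C | modulus z < d] = (@modulus R) @^-1` [set x | x < d] by [].
by apply: open_comp => [z _|]; [exact: modulus_continuous|exact: open_lt].
Qed.

Lemma poly_local_log p (w : C) : p.[0] = cexp w -> exists d L, [/\ 0 < d,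
  analytic_on [set z | modulus z < d] L, L 0 = w & forall z, modulus z < d -> cexp (L z) = p.[z]].
Proof.
move=> p0; pose q z : C := p.[z] / cexp w.
have dq z : derivable q z 1.
  by apply: derivableM; [exact: derivable_hornerC|exact: derivable_cst].
have q0 : q 0 = 1 by rewrite /q p0 divff // cexp_neq0.
have /derivable_cont/continuous_epsP/(_ _ ltr01)[d d0 H] := dq 0.
have Rq z : modulus z < d -> 0 < complex.Re (q z).
  rewrite -{1}(subr0 z) => /H; rewrite q0 => /(le_lt_trans (ge_Re _)).
  by case: (q z) => x y /=; rewrite ltr_norml => /andP[+ _]; rewrite ltrBrDl subrr.
exists d, (fun z => w + Log (q z)); split => //.
- move=> z zd; apply: derivableD; first exact: derivable_cst.
  by have [] := @is_derive1C_comp _ (@Log R) _ z _ _ (is_derive_Log (Rq z zd)) (derivableP (dq z)).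
- by rewrite q0 Log1 addr0.
- move=> z zd; rewrite cexpD cexp_Log; last exact: Rq.
  by rewrite /q mulrC divfK // cexp_neq0.
Qed.

End powers.

(** * Branches of powers and roots, and their jets *)

Section branches.
Context {R : realType}.
Local Notation C := (Cplx R).
Implicit Types (f g h G L M : C -> C) (z w : C) (d t : R) (p : {poly C}).

Lemma derivable_pow f n z : derivable f z 1 -> derivable (fun w => f w ^+ n) z 1.
Proof.
move=> df; elim: n => [|n IH].
  rewrite (_ : (fun _ => _) = cst 1); first exact: derivable_cst.
  by apply/funext => w; rewrite expr0.
rewrite (_ : (fun _ => _) = (fun w => f w * f w ^+ n)).
  by apply: derivableM; [exact: df|exact: IH].
by apply/funext => w; rewrite exprS.
Qed.

(** Whichever branch is chosen, near 0 it is given by an analytic logarithm of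
    the polynomial, which suffices to compute its jet. *)
Lemma local_powerP t N (c : 'I_N.+1 -> C) w : cexp w = c ord0 ->
  let g := local_power t (cexp (of_real t * w)) c in
  g 0 = cexp (of_real t * w) /\
  exists d L, [/\ 0 < d, deriv_ball L 0 d &
    forall z, modulus z < d -> cexp (L z) = (taylor_poly c).[z] /\ g z = cexp (of_real t * L z)].
Proof.
move=> cw /=.
have [] : [set g | g 0 = cexp (of_real t * w) /\ exists U, open_nbhs 0 U /\
    is_cpow_branch U t (horner (taylor_poly c)) g] (local_power t (cexp (of_real t * w)) c).
  apply: getPex.
  have [|d [L [d0 dL L0 HL]]] := @poly_local_log _ (taylor_poly c) w.
    by rewrite taylor_poly_at0.
  exists (fun z => cexp (of_real t * L z)); split; first by rewrite L0.
  exists [set z : C | modulus z < d]; split; first exact: open_ball0.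
  by exists L; split => // z zd; rewrite HL.
move=> g0 [U [oU [L [dL HL]]]]; split => //.
have /nbhsP[d d0 dU] := open_nbhs_nbhs oU.
exists d, L; split => //.
  by move=> z /dU Uz; exact: dL.
by move=> z zd; apply: HL; apply: dU; rewrite subr0.
Qed.

Lemma locally_bounded_derivable f d : 0 < d -> deriv_ball f 0 d ->
  exists K : R, exists2 d : R, 0 < d & forall z, modulus z < d -> modulus (f z) <= K.
Proof.
move=> d0 df; apply: cont_locally_bounded; apply: derivable_cont; apply: df.
by rewrite subrr modulus0.
Qed.

(** Write [f / g = exp e] with [e] vanishing at 0; then the quotient of the
    powers is [exp (e / t)], and [e] is as flat as [f / g - 1]. *)
Lemma power_flat n t d f g h G L M : t != 0 -> 0 < d ->
  deriv_ball L 0 d -> deriv_ball M 0 d ->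
  (forall z, modulus z < d -> [/\ h z = cexp (L z), g z = cexp (of_real t * L z),
     f z = cexp (M z) & G z = cexp (of_real t^-1 * M z)]) ->
  f 0 = g 0 -> G 0 = h 0 ->
  flat n (fun z => g z - f z) -> flat n (fun z => G z - h z).
Proof.
move=> t0 d0 dL dM H fg0 Gh0 lgf.
have tV : of_real t^-1 * of_real t = 1 :> C by rewrite -of_realM mulVf.
pose E z := M z - of_real t * L z.
pose e z := E z - E 0.
have dE : deriv_ball E 0 d.
  move=> z zd; apply: derivableB; first exact: dM.
  by apply: derivableM; [exact: derivable_cst|exact: dL].
have de : deriv_ball e 0 d.
  by move=> z zd; apply: derivableB; [exact: dE|exact: derivable_cst].
have in0 : modulus (0 : C) < d by rewrite modulus0.
have [h0 g0 f0 G0] := H 0 in0.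
have E0 : cexp (E 0) = 1.
  by rewrite /E cexpD cexpN -f0 -g0 fg0 divff // g0 cexp_neq0.
have E0' : cexp (of_real t^-1 * E 0) = 1.
  by rewrite /E mulrBr mulrA tV mul1r cexpD cexpN -G0 -h0 Gh0 divff // h0 cexp_neq0.
have ee z : modulus z < d -> cexp (e z) = f z / g z.
  move=> /H[_ gz fz _].
  by rewrite /e cexpD cexpN E0 divr1 /E cexpD cexpN -fz -gz.
have ee' z : modulus z < d -> cexp (of_real t^-1 * e z) = G z / h z.
  move=> /H[hz _ _ Gz].
  by rewrite /e mulrBr cexpD cexpN E0' divr1 /E mulrBr mulrA tV mul1r cexpD cexpN -hz -Gz.
have le : flat n (fun z => cexp (e z) - 1).
  apply: flat_near (_ : flat n (fun z => cexp (of_real (- t) * L z) * (- (g z - f z)))); last first.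
    apply: flatM; last exact: flatN.
    apply: (locally_bounded_derivable d0) => z zd.
    by apply: derivable_cexpZ; exact: dL.
  exists d => // z zd; rewrite ee //; have [_ gz _ _] := H z zd.
  have -> : cexp (of_real (- t) * L z) = (g z)^-1.
    by rewrite gz -cexpN /of_real rmorphN mulNr.
  have gz0 : g z != 0 by rewrite gz cexp_neq0.
  by rewrite opprB mulrBr mulVf // mulrC.
have ce : {for 0, continuous e}.
  by apply: derivable_cont; apply: de; rewrite subrr modulus0.
have e0 : e 0 = 0 by rewrite /e subrr.
have le' := flat_cexp_sub1 t^-1 ce e0 le.
apply: flat_near (_ : flat n (fun z => cexp (of_real 1 * L z) * (cexp (of_real t^-1 * e z) - 1))); last first.
  apply: flatM le'; apply: (locally_bounded_derivable d0) => z zd.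
  by apply: derivable_cexpZ; exact: dL.
exists d => // z zd; rewrite ee' //; have [hz _ _ _] := H z zd.
have -> : cexp (of_real 1 * L z) = h z by rewrite [of_real 1](_ : _ = 1) // mul1r hz.
have hz0 : h z != 0 by rewrite hz cexp_neq0.
by rewrite mulrBr mulr1 mulrC divfK.
Qed.

Lemma derivable_geom_sum f g s z : derivable f z 1 -> derivable g z 1 ->
  derivable (fun w => \sum_(i < s) f w ^+ (s.-1 - i) * g w ^+ i) z 1.
Proof.
move=> df dg.
apply: (@derivable_sum_seq _ _ (index_enum 'I_s) (fun i w => f w ^+ (s.-1 - i) * g w ^+ i)) => i _.
by apply: derivableM; exact: derivable_pow.
Qed.

(** If [G ^ s] and [h ^ s] agree to order [n] then so do [G] and [h]: the
    cofactor of [G - h] in [G ^ s - h ^ s] does not vanish at 0. *)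
Lemma root_flat n r s d f g h G : (0 < s)%N -> 0 < d ->
  deriv_ball f 0 d -> deriv_ball g 0 d -> deriv_ball h 0 d -> deriv_ball G 0 d ->
  (forall z, modulus z < d -> G z ^+ s = f z ^+ r) ->
  (forall z, modulus z < d -> h z ^+ s = g z ^+ r) ->
  G 0 = h 0 -> h 0 != 0 ->
  flat n (fun z => g z - f z) -> flat n (fun z => G z - h z).
Proof.
move=> s0 d0 df dg dh dG Gf hg Gh0 h00 lgf.
pose S z := \sum_(i < s) G z ^+ (s.-1 - i) * h z ^+ i.
pose T z := \sum_(i < r) f z ^+ (r.-1 - i) * g z ^+ i.
have in0 : modulus (0 - 0 : C) < d by rewrite subrr modulus0.
have dS : derivable S 0 1 by apply: derivable_geom_sum; [exact: dG|exact: dh].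
have dT : derivable T 0 1 by apply: derivable_geom_sum; [exact: df|exact: dg].
have S0 : S 0 != 0.
  rewrite /S Gh0 (eq_bigr (fun=> h 0 ^+ s.-1)); last first.
    by move=> i _; rewrite -exprD subnK // -ltnS prednK.
  by rewrite sumr_const card_ord mulrn_eq0 expf_eq0 (negbTE h00) andbF orbF -lt0n.
have dSV : derivable (fun z => (S z)^-1) 0 1 by apply: derivableV.
have SE z : G z ^+ s - h z ^+ s = (G z - h z) * S z by rewrite subrXX.
have TE z : f z ^+ r - g z ^+ r = (f z - g z) * T z by rewrite subrXX.
have [d1 d10 H1] : exists2 d1 : R, 0 < d1 & forall z, modulus z < d1 -> S z != 0.
  have mS0 : 0 < modulus (S 0) by rewrite modulus_gt0.
  have [d1 d10 H1] := (continuous_epsP _ _).1 (derivable_cont dS) _ mS0.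
  exists d1; first exact: d10.
  move=> z; have := H1 z; rewrite subr0 => H1z /H1z.
  by apply: contraTneq => ->; rewrite sub0r modulusN ltxx.
apply: flat_near (_ : flat n (fun z => (S z)^-1 * (T z * (- (g z - f z))))); last first.
  apply: (@flatM _ n (fun z => T z * (- (g z - f z))) (fun z => (S z)^-1)).
    exact: (cont_locally_bounded (derivable_cont dSV)).
  apply: (@flatM _ n (fun z => - (g z - f z)) T); last exact: flatN.
  exact: (cont_locally_bounded (derivable_cont dT)).
exists (Num.min d d1); first by rewrite lt_min d0.
move=> z; rewrite lt_min => /andP[zd /H1 Sz].
by rewrite opprB [T z * _]mulrC -TE -Gf // -hg // SE mulrC mulfK.
Qed.

(** A root in the disc has multiplicity divisible by [s], so that its factor has
    an [s]-th root that is a power; the factors of the other roots have a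
    logarithm on the disc. *)
Lemma disc_root_exists p r s (c0 : C) : (0 < s)%N -> p.[0] != 0 -> c0 ^+ s = p.[0] ^+ r ->
  (forall z, unit_disc z -> root p z -> (s %| mup z p)%N) ->
  exists g, [/\ g 0 = c0, analytic_on unit_disc g &
    forall z, unit_disc z -> g z ^+ s = p.[z] ^+ r].
Proof.
move=> s0 p0 c0s mult.
have [rs [mupE [pE rsP]]] := poly_roots_factor p0.
pose m a := count_mem a rs.
pose rho a z : C := if modulus a < 1 then (1 - z / a) ^+ ((m a %/ s) * r)
  else cexp (of_real (r%:R / s%:R) * Log (1 - z / a)) ^+ m a.
exists (fun z => c0 * \prod_(a <- undup rs) rho a z); split.
- rewrite big1 ?mulr1 // => a _; rewrite /rho; case: ifP => _.
    by rewrite mul0r subr0 expr1n.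
  by rewrite Log_sub_div0 mulr0 cexp0 expr1n.
- move=> z zD; apply: derivableM; first exact: derivable_cst.
  apply: derivable_prod_seq => a _; rewrite /rho; case: (boolP (modulus a < 1)) => [_|].
    by apply: derivable_pow; exact: derivable_sub_div.
  rewrite -leNgt => a1; apply: derivable_pow; apply: derivable_cexpZ.
  exact: derivable_Log_sub_div.
- move=> z zD; rewrite exprMn c0s (pE z) exprMn; congr (_ * _).
  rewrite -!prodrXl.
  have -> : \prod_(a <- rs) (1 - z / a) ^+ r = \prod_(a <- undup rs) ((1 - z / a) ^+ r) ^+ m a.
    by rewrite -prodr_undup_exp_count.
  rewrite !big_seq; apply: eq_bigr => a; rewrite mem_undup => ars.
  have [ra a0] := rsP a ars.
  rewrite /rho; case: ifPn => [a1|].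
    have dv : (s %| m a)%N by rewrite /m -mupE; exact: mult.
    by rewrite -!exprM mulnAC divnK // mulnC.
  rewrite -leNgt => a1; rewrite [LHS]exprAC; congr (_ ^+ _).
  rewrite -cexpMn -[_ *+ s in LHS]mulr_natl mulrA [s%:R * _](_ : _ = r%:R); last first.
    have -> : s%:R = of_real s%:R :> C by rewrite /of_real rmorph_nat.
    by rewrite -of_realM mulrC divfK ?pnatr_eq0 -?lt0n // /of_real rmorph_nat.
  rewrite mulr_natl cexpMn cexp_Log //; exact: Re_sub_div_gt0.
Qed.

End branches.

(** * Area is invariant under rotations *)

Section planar_measure.
Context {R : realType}.
Local Notation C := (Cplx R).
Local Notation mu := (@lebesgue_measure R).
Local Notation P := (measurableTypeR R * measurableTypeR R)%type.
Local Notation mu2 := ((mu \x mu)%E : set P -> \bar R).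

(** An open set is the union of the boxes with rational corners it contains. *)
Lemma open_measurable_plane (U : set (R * R)) : open U -> measurable (U : set P).
Proof.
move=> oU.
pose box (q : (rat * rat) * (rat * rat)) : set P :=
  `]ratr q.1.1, ratr q.1.2[ `*` `]ratr q.2.1, ratr q.2.2[.
have -> : (U : set P) = \bigcup_q (if `[< box q `<=` U >] then box q else set0).
  apply/seteqP; split => [[x y] Uxy|u [q _]]; last by case: asboolP => // /[apply].
  have /nbhs_ballP[e /= e0 eU] := open_nbhs_nbhs (conj oU Uxy).
  have xe1 : x - e < x by rewrite ltrBlDr ltrDl.
  have xe2 : x < x + e by rewrite ltrDl.
  have ye1 : y - e < y by rewrite ltrBlDr ltrDl.
  have ye2 : y < y + e by rewrite ltrDl.
  have [a] := rat_in_itvoo xe1; rewrite in_itv /= => /andP[a1 a2].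
  have [b] := rat_in_itvoo xe2; rewrite in_itv /= => /andP[b1 b2].
  have [c] := rat_in_itvoo ye1; rewrite in_itv /= => /andP[c1 c2].
  have [d] := rat_in_itvoo ye2; rewrite in_itv /= => /andP[d1 d2].
  exists ((a, b), (c, d)) => //; rewrite asboolT.
    by split; rewrite /= in_itv /= ?a2 ?c2.
  move=> [u v] [/=]; rewrite !in_itv /= => /andP[u1 u2] /andP[v1 v2].
  by apply: eU; split; rewrite /ball /= ltr_norml; lra.
apply: countable_bigcupT_measurable => // q; case: ifP => _ //.
by apply: measurableX; exact: measurable_itv.
Qed.

(** Translation invariance need only be checked on intervals. *)
Lemma lebesgue_measure_shift (a : R) (A : set (measurableTypeR R)) : measurable A ->
  mu ((fun x : R => x + a) @^-1` A) = mu A.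
Proof.
move=> mA.
have mf : measurable_fun [set: measurableTypeR R]
    (fun x : measurableTypeR R => (x + a : measurableTypeR R)).
  by apply: measurable_funD => //; exact: measurable_cst.
have H := @lebesgue_measure_unique R
  (@measure_function_pushforward__canonical__measure_function_Measure _ _ _ _ _ mu _ mf).
apply/esym; apply: H => //= _ [[x y]] _ <-.
rewrite /pushforward /=.
have -> : (fun x : R => x + a) @^-1` [set` `]x, y]] = [set` `](x - a), (y - a)]].
  by apply/seteqP; split => u /=; rewrite !in_itv /= ltrBlDr lerBrDr.
rewrite !lebesgue_measure_itv /= !lte_fin ltrD2r.
by case: ifP => // _; rewrite -!EFinB opprB addrA subrK.
Qed.

Definition measure_preserving (phi : P -> P) :=
  measurable_fun setT phi /\
  forall X : set P, measurable X -> mu2 (phi @^-1` X) = mu2 X.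

Lemma measure_preserving_comp phi psi :
  measure_preserving phi -> measure_preserving psi -> measure_preserving (phi \o psi).
Proof.
move=> [mphi phiE] [mpsi psiE]; split; first exact: measurableT_comp.
move=> X mX; rewrite comp_preimage psiE ?phiE //.
by rewrite -[X in measurable X]setTI; exact: mphi.
Qed.

Definition shear2 (t : R) (u : P) : P := (u.1, u.2 + t * u.1).
Definition shear1 (t : R) (u : P) : P := (u.1 + t * u.2, u.2).

Lemma measurable_shear2 t : measurable_fun setT (shear2 t).
Proof.
apply: measurable_fun_pair; first exact: measurable_fst.
by apply: measurable_funD; [exact: measurable_snd|
  apply: measurable_funM; [exact: measurable_cst|exact: measurable_fst]].
Qed.

Lemma measurable_shear1 t : measurable_fun setT (shear1 t).
Proof.
apply: measurable_fun_pair; last exact: measurable_snd.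
by apply: measurable_funD; [exact: measurable_fst|
  apply: measurable_funM; [exact: measurable_cst|exact: measurable_snd]].
Qed.

(** A shear translates every line of its direction, so Fubini's theorem reduces
    its effect on areas to translation invariance on the line. *)
Lemma shear2_preserving t : measure_preserving (shear2 t).
Proof.
have ms := measurable_shear2 t; split => // X mX.
have mX' : measurable (shear2 t @^-1` X) by rewrite -[X in measurable X]setTI; exact: ms.
rewrite /product_measure1; apply: eq_integral => x _ /=.
rewrite -(@lebesgue_measure_shift (t * x) (xsection X x)); last exact: measurable_xsection.
by congr (mu _).
Qed.

Lemma shear1_preserving t : measure_preserving (shear1 t).
Proof.
have ms := measurable_shear1 t; split => // X mX.
have mX' : measurable (shear1 t @^-1` X) by rewrite -[X in measurable X]setTI; exact: ms.
have E (Y : set P) : measurable Y -> mu2 Y = (mu \x^ mu)%E Y.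
  by move=> mY; apply: product_measure_unique => // A B mA mB /=; rewrite product_measure2E.
rewrite !E // /product_measure2; apply: eq_integral => y _ /=.
rewrite -(@lebesgue_measure_shift (t * y) (ysection X y)); last exact: measurable_ysection.
by congr (mu _).
Qed.

Definition rotation (c s : R) (u : P) : P := (c * u.1 - s * u.2, s * u.1 + c * u.2).

(** A rotation other than the half-turn is a product of three shears, and the
    half-turn is the square of a quarter-turn. *)
Lemma rotation_preserving c s : c ^+ 2 + s ^+ 2 = 1 -> measure_preserving (rotation c s).
Proof.
have main c' s' : c' != -1 -> c' ^+ 2 + s' ^+ 2 = 1 -> measure_preserving (rotation c' s').
  move=> c1 cs; have c10 : 1 + c' != 0 by apply: contraNneq c1 => h; apply/eqP; lra.
  have -> : rotation c' s' = shear1 (- s' / (1 + c')) \o (shear2 s' \o shear1 (- s' / (1 + c'))).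
    apply/funext => -[x y]; rewrite /rotation /shear1 /shear2 /=.
    have s2 : s' ^+ 2 = (1 - c') * (1 + c').
      by rewrite (_ : _ * _ = 1 - c' ^+ 2); [lra|ring].
    have e1 : s' * (- s' / (1 + c')) = c' - 1.
      by apply: (mulIf c10); rewrite mulrA divfK // mulrN -expr2 s2; ring.
    congr (_, _); last first.
      by rewrite mulrDr mulrA e1; ring.
    have -> : - s' / (1 + c') * (y + s' * (x + - s' / (1 + c') * y)) =
      - s' / (1 + c') * y + (s' * (- s' / (1 + c'))) * (x + - s' / (1 + c') * y) by ring.
    rewrite e1.
    have -> : x + - s' / (1 + c') * y + (- s' / (1 + c') * y + (c' - 1) * (x + - s' / (1 + c') * y)) =
      c' * x + (1 + c') * (- s' / (1 + c')) * y by ring.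
    by rewrite [(1 + c') * _]mulrC divfK // mulNr.
  by apply: measure_preserving_comp; [exact: shear1_preserving|
    apply: measure_preserving_comp; [exact: shear2_preserving|exact: shear1_preserving]].
move=> cs; have [c1|] := eqVneq c (-1); last by move=> ?; exact: main.
have s0 : s = 0.
  by apply/eqP; rewrite -sqrf_eq0; move: cs; rewrite c1 sqrrN expr1n => /eqP; rewrite -subr_eq0 addrC addKr.
have -> : rotation c s = rotation 0 1 \o rotation 0 1.
  by apply/funext => -[x y]; rewrite /rotation /= c1 s0; congr (_, _); ring.
have q : measure_preserving (rotation 0 1).
  by apply: main; [rewrite eq_sym oppr_eq0 oner_eq0|rewrite expr0n expr1n add0r].
exact: measure_preserving_comp.
Qed.

End planar_measure.

(** * Averaging over circles *)

Section circle_means.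
Context {R : realType}.
Local Notation C := (Cplx R).
Local Notation mu := (@lebesgue_measure R).
Local Notation T := (measurableTypeR R).
Local Notation P := (T * T)%type.
Local Notation mu2 := (mu \x mu)%E.
Local Notation disc2 := ((@of_pair R : P -> C) @^-1` unit_disc).

Lemma open_disc2 : open (disc2 : set (R * R)).
Proof.
apply: open_comp; first by move=> u _; exact: of_pair_continuous.
by have [] := @open_ball0 R 1 ltr01.
Qed.

Lemma measurable_disc2 : measurable (disc2 : set P).
Proof. by apply: open_measurable_plane; exact: open_disc2. Qed.

Lemma measurable_fun_disc2 (phi : C -> R) :
  (forall z, unit_disc z -> {for z, continuous phi}) ->
  measurable_fun disc2 (fun u : P => phi (of_pair u)).
Proof.
move=> cphi; apply: (measurability _ (RGenOInfty.measurableE R)) => //.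
move=> _ [_ [a ->] <-]; apply: open_measurable_plane.
rewrite openE => u [uD ua]; apply: filterI.
  by apply: open_nbhs_nbhs; split => //; exact: open_disc2.
have c : {for u, continuous (phi \o (@of_pair R : R * R -> C))}.
  by apply: continuous_comp; [exact: of_pair_continuous|exact: cphi].
apply: c; apply: open_nbhs_nbhs; split => //.
Qed.

Lemma preserving_integral (phi : P -> P) (g : P -> \bar R) :
  measure_preserving phi -> measurable_fun setT g ->
  (\int[mu2]_u g (phi u) = \int[mu2]_u g u)%E.
Proof.
move=> [mphi phiE].
have main (h : P -> \bar R) : measurable_fun setT h -> (forall u, 0 <= h u)%E ->
    (\int[mu2]_u h (phi u) = \int[mu2]_u h u)%E.
  move=> mh h0.
  have := @ge0_integral_pushforward _ _ _ _ R phi mphi mu2 setT h measurableT mh (fun u _ => h0 u).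
  rewrite preimage_setT => <-.
  by apply: eq_measure_integral => X mX _; exact: phiE.
move=> mg; rewrite integralE [RHS]integralE; congr (_ - _)%E.
  have -> : ((fun u => g (phi u))^\+ = g^\+ \o phi)%E by exact: funepos_comp.
  by apply: main => //; exact: measurable_funepos.
have -> : ((fun u => g (phi u))^\- = g^\- \o phi)%E by exact: funeneg_comp.
by apply: main => //; exact: measurable_funeneg.
Qed.

Lemma plane_sigma_finite : sigma_finite setT (mu \x mu)%E.
Proof.
exists (fun n : nat => [set` `[(- n%:R : R), n%:R]] `*` [set` `[(- n%:R : R), n%:R]]).
  apply/seteqP; split => // -[x y] _.
  pose n := (Num.truncn (`|x| + `|y|)).+1.
  have h : `|x| + `|y| < n%:R by exact: truncnS_gt.
  have x0 := normr_ge0 x; have y0 := normr_ge0 y.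
  by exists n => //; split; rewrite /= in_itv /= -ler_norml; lra.
move=> n; pose I : set T := [set` `[(- n%:R : R), n%:R]].
have mI : measurable I by exact: measurable_itv.
split; first exact: measurableX.
have muI : (mu I < +oo)%E.
  by rewrite /I lebesgue_measure_itv /=; case: ifP => _; rewrite ?ltry // -EFinB ltry.
have -> : (mu \x mu)%E (I `*` I) = (mu I * mu I)%E by exact: product_measure1E.
by apply: lte_mul_pinfty => //; rewrite ge0_fin_numE.
Qed.

Definition turn (t : R) : P -> P := rotation (cos t) (sin t).

Lemma of_pair_turn t u : of_pair (turn t u) = unit_circle t * of_pair u :> C.
Proof.
rewrite /turn /rotation /unit_circle /cexp /of_pair /= expR0 !mul1r.
by case: u => x y /=; congr (_ +i* _)%C; rewrite addrC.
Qed.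

Lemma turn_preserving t : measure_preserving (turn t).
Proof. by apply: rotation_preserving; rewrite cos2Dsin2. Qed.

Lemma turn_disc2 t u : disc2 (turn t u) <-> disc2 u.
Proof.
by rewrite /preimage /= /unit_disc /= of_pair_turn modulusM modulus_unit_circle mul1r.
Qed.

Lemma measurable_turn : measurable_fun setT (fun v : P * T => turn v.2 v.1).
Proof.
have mc : measurable_fun setT (fun v : P * T => cos v.2 : T).
  apply: (measurableT_comp (f := @cos R : T -> T)); last exact: measurable_snd.
  by apply: continuous_measurable_fun; exact: continuous_cos.
have ms : measurable_fun setT (fun v : P * T => sin v.2 : T).
  apply: (measurableT_comp (f := @sin R : T -> T)); last exact: measurable_snd.
  by apply: continuous_measurable_fun; exact: continuous_sin.
have m1 : measurable_fun setT (fun v : P * T => v.1.1 : T).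
  by apply: (measurableT_comp measurable_fst); exact: measurable_fst.
have m2 : measurable_fun setT (fun v : P * T => v.1.2 : T).
  by apply: (measurableT_comp measurable_snd); exact: measurable_fst.
apply: measurable_fun_pair.
  by apply: measurable_funB; apply: measurable_funM.
by apply: measurable_funD; apply: measurable_funM.
Qed.

Lemma mu_circle : mu `[0, pi *+ 2] = (pi *+ 2)%:E.
Proof.
rewrite lebesgue_measure_itv /= lte_fin mulrn_wgt0 ?pi_gt0 //=.
by rewrite oppr0 addr0.
Qed.

(** Averaging over all rotations about 0, which preserve area, replaces [Psi]
    by its means on the circles centred at 0. *)
Lemma integral_circle_mean0 (Psi : C -> R) :
  (forall z, unit_disc z -> {for z, continuous Psi}) ->
  mu2.-integrable disc2 (fun u => (Psi (of_pair u))%:E) ->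
  (forall z, unit_disc z ->
     \int[mu]_(t in `[0%R, (pi *+ 2)%R]) (Psi (unit_circle t * z))%:E = 0)%E ->
  (\int[mu2]_(u in disc2) (Psi (of_pair u))%:E = 0)%E.
Proof.
move=> cPsi iPsi mean0.
set g := ((fun u : P => (Psi (of_pair u))%:E) \_ disc2)%E.
have ig : mu2.-integrable setT g by exact: ((integrable_mkcond _ measurable_disc2).1 iPsi).
have mg : measurable_fun setT g by case/integrableP: ig.
rewrite integral_mkcond -/g.
pose J : set T := [set` `[(0 : R), pi *+ 2]].
have mJ : measurable J by exact: measurable_itv.
have intJ : (\int[mu]_t (\1_J t)%:E = (pi *+ 2)%:E)%E.
  by rewrite integral_indic // setIT; exact: mu_circle.
pose f (v : P * T) := ((\1_J v.2)%:E * g (turn v.2 v.1))%E.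
have mf : measurable_fun setT f.
  apply: emeasurable_funM.
    apply/measurable_EFinP; apply: (measurableT_comp (f := \1_J : T -> R)).
      exact: measurable_indic.
    exact: measurable_snd.
  exact: (measurableT_comp mg measurable_turn).
have mgt t : measurable_fun setT (fun u => g (turn t u)).
  by have [mt _] := turn_preserving t; exact: measurableT_comp.
have innerA t : (\int[mu2]_u `|f (u, t)| = (\1_J t)%:E * \int[mu2]_u `|g u|)%E.
  under eq_integral do rewrite /f /= abseM gee0_abs ?lee_fin //.
  rewrite ge0_integralZl_EFin //; last by apply: measurableT_comp => //; exact: mgt.
  congr (_ * _)%E; apply: (preserving_integral (phi := turn t) (g := fun u => `|g u|%E)).
    exact: turn_preserving.
  exact: measurableT_comp.
(* Fubini's theorem is applied to the plane times the line of angles. *)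
pose M2 : {sigma_finite_measure set P -> \bar R} :=
  HB.pack (mu \x mu)%E (Measure_isSigmaFinite.Build _ _ _ (mu \x mu)%E plane_sigma_finite).
have intf : (M2 \x mu)%E.-integrable setT f.
  have h0 := (@integrable21ltyP _ _ P T R M2 mu f mf).2.
  apply: h0.
  have gfin : (\int[mu2]_u `|g u|)%E \is a fin_num.
    by case/integrableP: ig => _ ?; rewrite ge0_fin_numE //; exact: integral_ge0.
  have g0 : 0 <= fine (\int[mu2]_u `|g u|)%E by apply: fine_ge0; exact: integral_ge0.
  have -> : (\int[mu]_t \int[M2]_u `|f (u, t)|)%E =
      (\int[mu]_t ((fine (\int[mu2]_u `|g u|))%:E * (\1_J t)%:E))%E.
    by apply: eq_integral => t _; rewrite fineK // muleC; exact: innerA.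
  rewrite ge0_integralZl_EFin //; last first.
    by apply/measurable_EFinP; exact: measurable_indic.
  by rewrite intJ -EFinM ltry.
have := Fubini intf.
have -> : (\int[M2]_u \int[mu]_t f (u, t) = 0)%E.
  apply: integral0_eq => u _.
  transitivity (\int[mu]_(t in J) g (turn t u))%E.
    rewrite [RHS]integral_mkcond; apply: eq_integral => t _.
    by rewrite /f /= patchE indicE; case: ifP => _; rewrite ?mul1e ?mul0e.
  have [uD|uD] := pselect (disc2 u).
    rewrite -[RHS](mean0 _ uD); apply: eq_integral => t _.
    rewrite /g patchE mem_set; last by apply/turn_disc2.
    by rewrite of_pair_turn.
  apply: integral0_eq => t _; rewrite /g patchE memNset //.
  by apply: contra_not uD => /turn_disc2.
have -> : (\int[mu]_t \int[M2]_u f (u, t) = \int[mu2]_u g u * (pi *+ 2)%:E)%E.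
  have gfin : (\int[mu2]_u g u)%E \is a fin_num by exact: integrable_fin_num.
  rewrite -(fineK gfin).
  transitivity (\int[mu]_t ((fine (\int[mu2]_u g u))%:E * (\1_J t)%:E))%E.
    apply: eq_integral => t _; rewrite /f /= fineK // muleC.
    have [tJ|tJ] := boolP (t \in J).
      rewrite indicE tJ /= mul1e; under eq_integral do rewrite mul1e.
      by apply: preserving_integral => //; exact: turn_preserving.
    rewrite indicE (negbTE tJ) /= mul0e; apply: integral0_eq => u _.
    by rewrite mul0e.
  rewrite integralZl //; last first.
    apply/integrableP; split; first by apply/measurable_EFinP; exact: measurable_indic.
    under eq_integral do rewrite gee0_abs ?lee_fin //.
    by rewrite intJ ltry.
  by rewrite intJ.
move=> /esym/eqP; rewrite mule_eq0 => /orP[/eqP //|].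
by rewrite eqe mulrn_eq0 /= gt_eqF // pi_gt0.
Qed.

End circle_means.

(** * Young's inequality with its equality case *)

Section young.
Context {R : realType}.
Implicit Types (x y p : R).

(** Weighted arithmetic-geometric mean inequality, from [1 + u <= exp u] at the
    logarithms of the two terms divided by their mean. *)
Lemma young_powR x y p : 0 < x -> 0 <= y -> 1 < p ->
  x `^ (p - 1) * y <= (1 - p^-1) * x `^ p + p^-1 * y `^ p /\
  (x `^ (p - 1) * y = (1 - p^-1) * x `^ p + p^-1 * y `^ p -> x = y).
Proof.
move=> x0 y0 p1; have p0 : 0 < p by lra.
have pV : 0 < p^-1 by rewrite invr_gt0.
have pV1 : p^-1 < 1 by rewrite invf_lt1.
have a0 : 0 < x `^ p by exact: powR_gt0.
set a := x `^ p in a0 *; set b := y `^ p; set A := (1 - p^-1) * a + p^-1 * b.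
have qa : 0 < (1 - p^-1) * a by rewrite mulr_gt0 // subr_gt0.
have [y_0|yn0] := eqVneq y 0.
  have A0 : 0 < A by rewrite /A /b y_0 powR0 ?gt_eqF // mulr0 addr0.
  by rewrite {1 2}y_0 mulr0; split; [exact: ltW|move=> E; rewrite -E ltxx in A0].
have yp : 0 < y by rewrite lt_def yn0.
have b0 : 0 < b by exact: powR_gt0.
have A0 : 0 < A by rewrite /A addr_gt0 // mulr_gt0.
set u := ln (a / A); set v := ln (b / A).
have eu : expR u = a / A by rewrite lnK // posrE divr_gt0.
have ev : expR v = b / A by rewrite lnK // posrE divr_gt0.
have sum1 : (1 - p^-1) * expR u + p^-1 * expR v = 1.
  by rewrite eu ev !mulrA -mulrDl divff // gt_eqF.
have uE : u = p * ln x - ln A by rewrite /u ln_div ?posrE // ln_powR.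
have vE : v = p * ln y - ln A by rewrite /v ln_div ?posrE // ln_powR.
have xy : x `^ (p - 1) * y = expR ((p - 1) * ln x + ln y).
  by rewrite expRD lnK ?posrE // /powR gt_eqF.
have comb : (1 - p^-1) * u + p^-1 * v = (p - 1) * ln x + ln y - ln A.
  by rewrite uE vE; field; rewrite gt_eqF.
have hu : (1 - p^-1) * (1 + u) <= (1 - p^-1) * expR u.
  by rewrite ler_pM2l ?subr_gt0 // expR_ge1Dx.
have hv : p^-1 * (1 + v) <= p^-1 * expR v by rewrite ler_pM2l // expR_ge1Dx.
have AE : A = expR (ln A) by rewrite lnK.
clear eu ev; clearbody u v A; clear qa a0 b0.
have lnA : (p - 1) * ln x + ln y <= ln A by lra.
split; first by rewrite xy AE ler_expR.
rewrite xy => E.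
have {}E : (p - 1) * ln x + ln y = ln A by apply: expR_inj; rewrite -AE.
have p1' : 0 < 1 - p^-1 by rewrite subr_gt0.
have u0 : u = 0.
  apply/eqP; apply: contraPT (lexx (1 : R)) => /expR_gt1Dx hu'.
  have : (1 - p^-1) * (1 + u) < (1 - p^-1) * expR u by rewrite ltr_pM2l.
  lra.
have v0 : v = 0.
  apply/eqP; apply: contraPT (lexx (1 : R)) => /expR_gt1Dx hv'.
  have : p^-1 * (1 + v) < p^-1 * expR v by rewrite ltr_pM2l.
  lra.
have : p * ln x = p * ln y by lra.
by move/(mulfI (lt0r_neq0 p0)) => /ln_inj; apply; rewrite posrE.
Qed.

End young.

(** * Conjugate polynomials are orthogonal to functions of high order *)

Section orthogonality.
Context {R : realType}.
Local Notation C := (Cplx R).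
Local Notation mu := (@lebesgue_measure R).
Implicit Types (z w : C) (p : {poly C}).

Definition conj (z : C) : C := conjc z.

Lemma conjD z w : conj (z + w) = conj z + conj w.
Proof. by case: z w => a b [c d]; rewrite /conj /= opprD. Qed.

Lemma conjM z w : conj (z * w) = conj z * conj w.
Proof.
case: z w => a b [c d]; rewrite /conj /=.
by apply/eqP; rewrite eq_complex /=; apply/andP; split; apply/eqP; ring.
Qed.

Lemma conj0 : conj 0 = 0.
Proof. by rewrite /conj /= oppr0. Qed.

Lemma conj1 : conj 1 = 1.
Proof. by rewrite /conj /= oppr0. Qed.

Lemma conjX z n : conj (z ^+ n) = conj z ^+ n.
Proof. by elim: n => [|n IH]; rewrite ?expr0 ?conj1 // !exprS conjM IH. Qed.

Lemma conj_sum (I : Type) (s : seq I) (F : I -> C) :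
  conj (\sum_(i <- s) F i) = \sum_(i <- s) conj (F i).
Proof. by elim: s => [|i s IH]; rewrite ?big_nil ?conj0 // !big_cons conjD IH. Qed.

Lemma modulus_conj z : modulus (conj z) = modulus z.
Proof. by case: z => a b; rewrite /conj /modulus /= sqrrN. Qed.

Lemma conj_mul z : conj z * z = of_real (modulus z ^+ 2).
Proof.
case: z => a b; rewrite /conj /modulus /of_real /= sqr_sqrtr ?addr_ge0 ?sqr_ge0 //.
by apply/eqP; rewrite eq_complex /=; apply/andP; split; apply/eqP; ring.
Qed.

Lemma conj_unit_circle t : conj (unit_circle t) = (unit_circle t)^-1 :> C.
Proof.
apply: (mulIf (unit_circle_neq0 t)).
by rewrite conj_mul modulus_unit_circle expr1n mulVf // unit_circle_neq0.
Qed.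

Lemma conj_continuous : continuous conj.
Proof.
move=> z; apply/continuous_epsP => e e0; exists e => // w.
by rewrite (_ : conj w - conj z = conj (w - z)) ?modulus_conj //;
  case: w z => a b [c d]; rewrite /conj /= opprD.
Qed.

Lemma Re_of_modulus z : complex.Re z = modulus z -> z = of_real (modulus z).
Proof.
case: z => a b /= E; rewrite -E /of_real; apply/eqP; rewrite eq_complex /= eqxx /=.
have /eqP : a ^+ 2 = modulus (a +i* b : C)%C ^+ 2 by rewrite -E.
rewrite /modulus /= sqr_sqrtr ?addr_ge0 ?sqr_ge0 //.
by rewrite -[X in X == _]addr0 (inj_eq (addrI _)) eq_sym sqrf_eq0.
Qed.

Lemma cint_sum_eq0 n (k : nat -> C) (g : nat -> R -> C) (a b : R) :
  (forall j, (j < n)%N -> cont_itv (g j) a b /\ cint (g j) a b = 0) ->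
  cont_itv (fun t => \sum_(j < n) k j * g j t) a b /\
  cint (fun t => \sum_(j < n) k j * g j t) a b = 0.
Proof.
elim: n => [_|n IH H].
  rewrite (_ : (fun _ => _) = cst 0); last by apply/funext => t; rewrite big_ord0.
  have c : cont_itv (cst (0 : C)) a b by move=> t _; exact: cvg_cst.
  split=> //; have := cintZ 0 c; rewrite mul0r => E; rewrite -[RHS]E.
  by apply: eq_cint => t _; rewrite mul0r.
have [c0 i0] : _ /\ _ := IH (fun j jn => H j (ltnW jn)).
have [cn jn] := H n (ltnSn n).
have ckn : cont_itv (fun t => k n * g n t) a b.
  by move=> t tI; apply: (@cvgM _ _ (nbhs t)); [exact: cvg_cst|exact: cn].
rewrite (_ : (fun _ => _) = (fun t => \sum_(j < n) k j * g j t + k n * g n t)); last first.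
  by apply/funext => t; rewrite big_ord_recr.
split; last by rewrite (cintD c0 ckn) i0 (cintZ _ cn) jn mulr0 addr0.
by move=> t tI; apply: (@cvgD _ _ _ (nbhs t)); [exact: c0|exact: ckn].
Qed.

(** Applied to [K (z * .)], which is analytic slightly beyond the unit circle. *)
Lemma flat_circle_coef n (K : C -> C) z j : unit_disc z -> analytic_on unit_disc K -> flat n K ->
  (j <= n)%N ->
  cont_itv (fun t => K (z * unit_circle t) * (unit_circle t) ^- j) 0 (pi *+ 2) /\
  cint (fun t => K (z * unit_circle t) * (unit_circle t) ^- j) 0 (pi *+ 2) = 0.
Proof.
move=> zD dK lK jn; have z0 := modulus_ge0 z; have z1 : modulus z < 1 := zD.
(* The radius [2 / (1 + |z|)] exceeds 1 and is less than [1 / |z|]. *)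
have dzw (w : C) : modulus w < 2 / (1 + modulus z) -> derivable (fun w => K (z * w)) w 1.
  move=> wd.
  have dl : derivable (fun w : C => z * w) w 1.
    by apply: derivableM; [exact: derivable_cst|exact: derivable_id].
  have dKw : derivable K (z * w) 1.
    apply: dK; rewrite /unit_disc /= modulusM.
    rewrite ltr_pdivlMr in wd; last lra.
    have := modulus_ge0 w; nra.
  by have [] := @is_derive1C_comp _ K _ w _ _ (derivableP dKw) (derivableP dl).
have d1 : 1 < 2 / (1 + modulus z) by rewrite ltr_pdivlMr; lra.
split.
  move=> t _; apply: (@cvgM _ _ (nbhs t)).
    have : {for t, continuous ((fun w => K (z * w)) \o unit_circle)}.
      apply: continuous_comp; first exact: unit_circle_continuous.
      by apply: derivable_cont; apply: dzw; rewrite modulus_unit_circle.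
    exact.
  apply: (@cvgV _ _ (nbhs t)); first by rewrite expf_neq0 // unit_circle_neq0.
  have : {for t, continuous ((fun w : C => w ^+ j) \o unit_circle)}.
    apply: continuous_comp; first exact: unit_circle_continuous.
    by apply: derivable_cont; apply: derivable_pow; exact: derivable_id.
  exact.
apply: (circle_coef_eq0 d1 dzw) => e e0.
have [r r0 rP] := flat_le jn lK e0.
exists r => // w wr.
have zw : modulus (z * w) <= modulus w.
  by rewrite modulusM ler_piMl ?modulus_ge0 // ltW.
apply: le_trans (rP _ (le_lt_trans zw wr)) _.
by rewrite ler_pM2l // lerXn2r // nnegrE modulus_ge0.
Qed.

(** On a circle centred at 0 the conjugate of a polynomial of degree at most
    [n] only involves the frequencies [0, -1, .., -n], which [K] lacks. *)
Lemma circle_mean_conj_poly n p (K : C -> C) z : (size p <= n.+1)%N ->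
  unit_disc z -> analytic_on unit_disc K -> flat n K ->
  (\int[mu]_(t in `[0%R, (pi *+ 2)%R])
     (complex.Re (conj p.[unit_circle t * z] * K (unit_circle t * z)))%:E = 0)%E.
Proof.
move=> sp zD dK lK.
pose g j t := K (z * unit_circle t) * (unit_circle t) ^- j.
pose k j := conj (p`_j * z ^+ j).
have [c i] := @cint_sum_eq0 (size p) k g 0 (pi *+ 2)
  (fun j jp => flat_circle_coef zD dK lK (leq_trans jp sp)).
have E : (fun t : R => conj p.[unit_circle t * z] * K (unit_circle t * z)) =
    (fun t => \sum_(j < size p) k j * g j t).
  apply/funext => t; rewrite horner_coef conj_sum mulr_suml [unit_circle t * z]mulrC.
  apply: eq_bigr => j _; rewrite /k /g.
  have -> : p`_j * (z * unit_circle t) ^+ j = p`_j * z ^+ j * unit_circle t ^+ j.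
    by rewrite exprMn mulrA.
  by rewrite conjM conjX conj_unit_circle exprVn -mulrA [in RHS](mulrC (K _)).
have iR := cont_itv_Re c.
have h : \int[mu]_(t in `[0%R, (pi *+ 2)%R]) complex.Re (\sum_(j < size p) k j * g j t) = 0.
  exact: (congr1 (@complex.Re R) i).
transitivity (\int[mu]_(t in `[0%R, (pi *+ 2)%R])
    (complex.Re (\sum_(j < size p) k j * g j t))%:E)%E.
  by apply: eq_integral => t _; rewrite -[in RHS](congr1 (fun f => f t) E).
rewrite -[LHS]fineK; last by apply: integrable_fin_num.
by rewrite [X in X%:E]h.
Qed.

End orthogonality.

(** * The integral of the p-th power of the modulus *)

Section bergman_integral.
Context {R : realType}.
Local Notation C := (Cplx R).
Local Notation mu := (@lebesgue_measure R).
Local Notation T := (measurableTypeR R).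
Local Notation P := (T * T)%type.
Local Notation mu2 := (mu \x mu)%E.
Local Notation disc2 := ((@of_pair R : P -> C) @^-1` unit_disc).
Implicit Types (F G K q : C -> C) (f : {poly C}) (p : R).

Lemma powR_modulus_continuous F p z : 0 < p -> {for z, continuous F} ->
  {for z, continuous (fun w => modulus (F w) `^ p)}.
Proof.
move=> p0 cF.
have cm : {for z, continuous ((@modulus R) \o F)}.
  by apply: continuous_comp; [exact: cF|exact: modulus_continuous].
have [F0|F0] := eqVneq (modulus (F z)) 0.
  apply/continuous_C2RP => e e0.
  have e'0 : 0 < e `^ p^-1 by exact: powR_gt0.
  have [d d0 H] := (continuous_C2RP _ _).1 cm _ e'0.
  exists d => // w /H /=; rewrite F0 powR0 ?gt_eqF // !subr0.
  rewrite ger0_norm ?modulus_ge0 // ger0_norm ?powR_ge0 // => h.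
  have -> : e = (e `^ p^-1) `^ p by rewrite -powRrM mulVf ?gt_eqF // powRr1 // ltW.
  by apply: gt0_ltr_powR => //; rewrite nnegrE ?modulus_ge0 // ltW.
have Fp : 0 < modulus (F z) by rewrite lt_def F0 modulus_ge0.
have : {for z, continuous ((fun x : R => x `^ p) \o ((@modulus R) \o F))}.
  apply: continuous_comp; first exact: cm.
  apply/differentiable_continuous/derivable1_diffP; apply: derivable_powR.
  by rewrite in_itv /= Fp.
exact.
Qed.

Lemma analytic_cont F z : analytic_on unit_disc F -> unit_disc z -> {for z, continuous F}.
Proof. by move=> dF /dF; exact: derivable_cont. Qed.

Definition pth_power_integral p F : \bar R :=
  (\int[mu2]_(u in disc2) (modulus (F (of_pair u)) `^ p)%:E)%E.

Lemma pth_power_integral_ge0 p F : (0 <= pth_power_integral p F)%E.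
Proof. by apply: integral_ge0 => u _; rewrite lee_fin powR_ge0. Qed.

Lemma bergman_normE p F :
  bergman_norm p F = (((pi^-1)%:E * pth_power_integral p F) `^ p^-1)%E.
Proof. by []. Qed.

Lemma piV_gt0 : 0 < pi^-1 :> R. Proof. by rewrite invr_gt0 pi_gt0. Qed.

Lemma bergman_norm_fin p F : 0 < p ->
  (bergman_norm p F < +oo)%E <-> (pth_power_integral p F < +oo)%E.
Proof.
move=> p0; have I0 := pth_power_integral_ge0 p F; rewrite bergman_normE; split.
  move/(lty_poweRy _); rewrite invr_eq0 gt_eqF // => /(_ isT).
  move: (pth_power_integral p F) I0 => [x| |//] I0; first by move=> _; exact: ltry.
  by rewrite gt0_muley ?lte_fin ?piV_gt0.
move=> fin; apply: poweR_lty; apply: lte_mul_pinfty => //.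
by rewrite lee_fin ltW // piV_gt0.
Qed.

Lemma bergman_norm_le p F G : 0 < p -> (bergman_norm p F <= bergman_norm p G)%E ->
  (pth_power_integral p F <= pth_power_integral p G)%E.
Proof.
move=> p0; have IF := pth_power_integral_ge0 p F; have IG := pth_power_integral_ge0 p G.
have pi0 := piV_gt0.
have inv (x y : \bar R) : (0 <= x)%E -> (0 <= y)%E -> (x `^ p^-1 <= y `^ p^-1)%E -> (x <= y)%E.
  move=> x0 y0 xy.
  have in0 (a : \bar R) : (0 <= a)%E -> a \in `[0%E, +oo%E].
    by move=> a0; rewrite in_itv /= a0 leey.
  have := gt0_ler_poweR (ltW p0) (in0 _ (poweR_ge0 x p^-1)) (in0 _ (poweR_ge0 y p^-1)) xy.
  by rewrite /= -(poweRrM x) -(poweRrM y) mulVf ?gt_eqF // (poweRe1 x0) (poweRe1 y0).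
rewrite !bergman_normE => /inv h.
have := h (mule_ge0 _ IF) (mule_ge0 _ IG).
rewrite lee_fin (ltW pi0) lee_pmul2l //; first by apply.
Qed.

Lemma mu2_disc_fin : (mu2 disc2 < +oo)%E.
Proof.
pose I : set T := [set` `[(- 1 : R), 1]].
have mI : measurable I by exact: measurable_itv.
have muI : (mu I < +oo)%E.
  by rewrite /I lebesgue_measure_itv /=; case: ifP => _; rewrite ?ltry // -EFinB ltry.
apply: (@le_lt_trans _ _ (mu2 (I `*` I))); last first.
  have -> : mu2 (I `*` I) = (mu I * mu I)%E by exact: product_measure1E.
  by apply: lte_mul_pinfty => //; rewrite ge0_fin_numE.
apply: le_measure; rewrite ?inE; [exact: measurable_disc2|exact: measurableX|].
move=> [x y] xyD; have xy : modulus (of_pair (x, y) : C) < 1 := xyD.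
split; rewrite /I /= in_itv /= -ler_norml.
  by apply: le_trans (ge_Re _) (ltW xy).
by apply: le_trans (ge_Im _) (ltW xy).
Qed.

Lemma integrable_pth_power p F : 0 < p -> analytic_on unit_disc F ->
  (pth_power_integral p F < +oo)%E ->
  mu2.-integrable disc2 (EFin \o (fun u => modulus (F (of_pair u)) `^ p)).
Proof.
move=> p0 dF fin; apply/integrableP; split.
  apply/measurable_EFinP; apply: (measurable_fun_disc2 (phi := fun z => modulus (F z) `^ p)).
  by move=> z zD; apply: powR_modulus_continuous => //; exact: analytic_cont.
under eq_integral do rewrite /= ger0_norm ?powR_ge0 //.
exact: fin.
Qed.

Lemma poly_bounded_on_disc f : exists M : R, forall z, unit_disc z -> modulus f.[z] <= M.
Proof.
exists (\sum_(i < size f) modulus f`_i) => z zD; rewrite horner_coef.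
have z1 : modulus z <= 1 by exact: ltW.
elim: (size f) => [|n IH]; first by rewrite !big_ord0 modulus0.
rewrite !big_ord_recr /=; apply: le_trans (modulusD _ _) _; apply: lerD => //.
by rewrite modulusM modulusX ler_piMr ?modulus_ge0 // exprn_ile1 // modulus_ge0.
Qed.

Lemma pth_power_integral_root_fin p f G : 0 < p ->
  (forall z, unit_disc z -> modulus (G z) `^ p = modulus f.[z] ^+ 2) ->
  (pth_power_integral p G < +oo)%E.
Proof.
move=> p0 Gf; have [M fM] := poly_bounded_on_disc f.
have M0 : 0 <= M.
  by apply: le_trans (fM 0 _); rewrite ?modulus_ge0 // /unit_disc /= modulus0.
apply: (@le_lt_trans _ _ (\int[mu2]_(u in disc2) (M ^+ 2)%:E)%E).
  apply: ge0_le_integral => //=.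
  - exact: measurable_disc2.
  - by move=> u _; rewrite lee_fin powR_ge0.
  - apply/measurable_EFinP; apply: (eq_measurable_fun (fun u => modulus f.[of_pair u] ^+ 2)).
      by move=> u /set_mem uD; rewrite Gf.
    apply: (measurable_fun_disc2 (phi := fun z => modulus f.[z] ^+ 2)) => z zD.
    have c : {for z, continuous (fun w => modulus f.[w])}.
      have : {for z, continuous ((@modulus R) \o (horner f))}.
        by apply: continuous_comp; [apply: derivable_cont; exact: derivable_hornerC|
          exact: modulus_continuous].
      exact.
    by apply: (@cvgM _ _ (nbhs z)).
  - by move=> u uD; rewrite lee_fin Gf // lerXn2r ?nnegrE ?modulus_ge0 // fM.
rewrite integral_cst; last exact: measurable_disc2.
by apply: lte_mul_pinfty; [rewrite lee_fin sqr_ge0|by []|exact: mu2_disc_fin].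
Qed.

(** If [phi] were positive at a point it would be so on a small square, which has
    positive area, while [phi] vanishes almost everywhere. *)
Lemma continuous_eq0_of_integral (phi : C -> R) :
  (forall z, unit_disc z -> {for z, continuous phi}) ->
  (forall z, unit_disc z -> 0 <= phi z) ->
  (\int[mu2]_(u in disc2) (phi (of_pair u))%:E = 0)%E ->
  forall z, unit_disc z -> phi z = 0.
Proof.
move=> cphi phi0 int0 [x y] zD; apply/eqP; rewrite eq_le phi0 // andbT leNgt.
apply/negP => phipos.
have mphi : measurable_fun disc2 (EFin \o (fun u : P => phi (of_pair u))).
  by apply/measurable_EFinP; exact: measurable_fun_disc2.
have : ae_eq mu2 disc2 (EFin \o (fun u : P => phi (of_pair u))) (cst 0%E).
  apply/(ae_eq_integral_abs _ measurable_disc2 mphi).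
  rewrite -[RHS]int0; apply: eq_integral => u /set_mem uD.
  by rewrite /= ger0_norm // phi0.
move=> [A [mA A0 subA]].
have [d1 d10 H1] := unit_disc_ball zD.
have [d2 d20 H2] := (continuous_C2RP _ _).1 (cphi _ zD) _ phipos.
pose e := Num.min d1 d2 / 2.
have m0 : 0 < Num.min d1 d2 by rewrite lt_min d10.
have e0 : 0 < e by rewrite /e divr_gt0.
pose I (a : R) : set T := [set` `](a - e), (a + e)[].
have mI a : measurable (I a) by exact: measurable_itv.
have muI a : mu (I a) = (2 * e)%:E.
  rewrite /I lebesgue_measure_itv /= lte_fin ifT; last lra.
  by rewrite -EFinB; congr EFin; ring.
have : (mu2 (I x `*` I y) <= mu2 A)%E.
  apply: le_measure; rewrite ?inE //; first exact: measurableX.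
  apply: subset_trans subA => -[a b] [/= aI bI].
  move: aI bI; rewrite /I /= !in_itv /= => /andP[a1 a2] /andP[b1 b2].
  have dist : modulus ((a +i* b : C)%C - (x +i* y)%C) < Num.min d1 d2.
    apply: le_lt_trans (modulus_le _) _ => /=.
    have -> : Num.min d1 d2 = e + e by rewrite /e -splitr.
    by apply: ltrD; rewrite ltr_norml; lra.
  move: dist; rewrite lt_min => /andP[/H1 abD /H2 abphi] /= nE.
  have E0 : (phi (a +i* b)%C)%:E = 0%E := nE abD.
  have E : phi (a +i* b)%C = 0 by case: E0.
  by move: abphi; rewrite E sub0r normrN gtr0_norm // ltxx.
rewrite A0.
have -> : mu2 (I x `*` I y) = (mu (I x) * mu (I y))%E by exact: product_measure1E.
by rewrite !muI -EFinM lee_fin leNgt mulr_gt0 // mulr_gt0.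
Qed.

End bergman_integral.

(** * The extremal function *)

Section extremal.
Context {R : realType}.
Local Notation C := (Cplx R).
Local Notation mu := (@lebesgue_measure R).
Local Notation T := (measurableTypeR R).
Local Notation P := (T * T)%type.
Local Notation mu2 := (mu \x mu)%E.
Local Notation disc2 := ((@of_pair R : P -> C) @^-1` unit_disc).
Implicit Types (F G K q : C -> C) (f : {poly C}) (p : R).

(** At a point of the disc, [x], [y], [a], [b] are the values of [F], [G], [f] and
    [q = f / G]. Then [conj a * b] has modulus [|y| ^ (p - 1)], so Young's
    inequality applies. In the case of equality [|x| = |y|], and [conj a * b * x]
    is its own modulus, as is [conj a * b * y = |y| ^ p]; hence [x = y]. *)
Lemma young_modulus p (x y a b : C) : 1 < p -> a = b * y ->
  modulus y `^ p = modulus a ^+ 2 ->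
  let gap := p^-1 * modulus x `^ p + (1 - p^-1) * modulus y `^ p
             - complex.Re (conj a * (b * x)) in
  modulus (conj a * (b * x)) <= p^-1 * modulus x `^ p + (1 - p^-1) * modulus y `^ p /\
  (gap = 0 -> x = y).
Proof.
move=> p1 aE ya /=; have p0 : 0 < p by lra.
have pV : 0 < p^-1 by rewrite invr_gt0.
have pV1 : p^-1 < 1 by rewrite invf_lt1.
have [y0|y0] := eqVneq y 0.
  have a0 : a = 0 by rewrite aE y0 mulr0.
  rewrite a0 conj0 mul0r y0 modulus0 powR0 ?gt_eqF // mulr0 addr0; split.
    by rewrite mulr_ge0 ?powR_ge0 // ltW.
  rewrite subr0 => /eqP; rewrite mulf_eq0 gt_eqF //= powR_eq0 modulus_eq0.
  by case/andP => /eqP.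
have my : 0 < modulus y by rewrite modulus_gt0.
have map : 0 < modulus a ^+ 2 by rewrite -ya powR_gt0.
have ma : 0 < modulus a.
  by rewrite lt_def modulus_ge0 andbT; apply: contraTneq map => ->; rewrite expr0n ltxx.
have mab : modulus (conj a * b) = modulus y `^ (p - 1).
  apply: (mulIf (lt0r_neq0 my)); rewrite -modulusM -mulrA -aE modulusM modulus_conj.
  by rewrite mulrC -expr2 -ya mulrC mulr_powRB1 // modulus_ge0.
set w := conj a * (b * x).
have mw : modulus w = modulus y `^ (p - 1) * modulus x.
  by rewrite /w mulrA modulusM mab.
have [yl yeq] := young_powR my (modulus_ge0 x) p1.
have Rw : complex.Re w <= modulus w by apply: le_trans (ler_norm _) (ge_Re _).
rewrite mw [p^-1 * _ + _]addrC; split => // gap0.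
have e1 : modulus y `^ (p - 1) * modulus x =
    (1 - p^-1) * modulus y `^ p + p^-1 * modulus x `^ p.
  by rewrite mw in Rw; lra.
have e2 : complex.Re w = modulus w by rewrite mw; lra.
have xy := yeq e1.
have wE : w = conj a * (b * y).
  rewrite (Re_of_modulus e2) mw -xy mulrC mulr_powRB1 ?modulus_ge0 //.
  by rewrite ya -aE conj_mul.
have cab : conj a * b != 0 by rewrite -modulus_eq0 mab gt_eqF // powR_gt0.
by apply: (mulfI cab); rewrite -!mulrA.
Qed.

(** With [W = F - G], the function [conj f * q * W] integrates to 0 over the
    disc, so that the integral of Young's gap between [|G| ^ (p - 1) |F|] and
    [|F| ^ p / p + (1 - 1 / p) |G| ^ p] is at most 0. *)
Lemma extremal_unique p N f F G q : 1 < p -> (size f <= N.+1)%N ->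
  analytic_on unit_disc F -> analytic_on unit_disc G -> analytic_on unit_disc q ->
  (forall z, unit_disc z -> modulus (G z) `^ p = modulus f.[z] ^+ 2) ->
  (forall z, unit_disc z -> f.[z] = q z * G z) ->
  flat N (fun z => F z - G z) ->
  (pth_power_integral p F < +oo)%E ->
  (pth_power_integral p F <= pth_power_integral p G)%E ->
  forall z, unit_disc z -> F z = G z.
Proof.
move=> p1 sf dF dG dq Gf fq lW Ffin FG.
have p0 : 0 < p by lra.
have pV : 0 < p^-1 by rewrite invr_gt0.
have pV1 : p^-1 < 1 by rewrite invf_lt1.
have Gfin := pth_power_integral_root_fin p0 Gf.
pose K z := q z * (F z - G z).
pose Psi z := complex.Re (conj f.[z] * K z).
pose hF z := modulus (F z) `^ p.
pose hG z := modulus (G z) `^ p.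
pose Phi z := p^-1 * (hF z - hG z) - Psi z.
have dW : analytic_on unit_disc (fun z => F z - G z).
  by move=> z zD; apply: derivableB; [exact: dF|exact: dG].
have dK : analytic_on unit_disc K.
  by move=> z zD; apply: derivableM; [exact: dq|exact: dW].
have lK : flat N K.
  have := @flatM R N (fun z => F z - G z) q; apply; last exact: lW.
  apply: cont_locally_bounded; apply: (analytic_cont dq).
  by rewrite /unit_disc /= modulus0.
have PhiE z : unit_disc z -> Phi z = p^-1 * modulus (F z) `^ p + (1 - p^-1) * modulus (G z) `^ p
    - complex.Re (conj f.[z] * (q z * F z)).
  move=> zD; rewrite /Phi /hF /hG /Psi /K.
  have -> : conj f.[z] * (q z * (F z - G z)) =
      conj f.[z] * (q z * F z) - of_real (modulus (G z) `^ p).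
    by rewrite Gf // -conj_mul {4}fq //; ring.
  case: (conj f.[z] * (q z * F z)) => a b; rewrite /of_real /=.
  by ring.
have YM z : unit_disc z -> _ := fun zD =>
  @young_modulus p (F z) (G z) f.[z] (q z) p1 (fq z zD) (Gf z zD).
have Phi_ge0 z : unit_disc z -> 0 <= Phi z.
  move=> zD; rewrite PhiE // subr_ge0; have [h _] := YM z zD.
  by apply: le_trans h; apply: le_trans (ler_norm _) (ge_Re _).
have cPsi z : unit_disc z -> {for z, continuous Psi}.
  move=> zD.
  have c1 : {for z, continuous (conj \o (horner f))}.
    apply: continuous_comp; last exact: conj_continuous.
    by apply: derivable_cont; exact: derivable_hornerC.
  have c2 : {for z, continuous (fun w => conj f.[w] * K w)}.
    by apply: (@cvgM _ _ (nbhs z)); [exact: c1|exact: analytic_cont].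
  have : {for z, continuous ((@complex.Re R) \o (fun w => conj f.[w] * K w))}.
    by apply: continuous_comp; [exact: c2|exact: Re_continuous].
  exact.
have cPhi z : unit_disc z -> {for z, continuous Phi}.
  move=> zD; apply: (@cvgB _ _ _ (nbhs z)); last exact: cPsi.
  apply: (@cvgM _ _ (nbhs z)); first exact: cvg_cst.
  by apply: (@cvgB _ _ _ (nbhs z)); apply: powR_modulus_continuous => //; exact: analytic_cont.
have iF := integrable_pth_power p0 dF Ffin.
have iG := integrable_pth_power p0 dG Gfin.
have mD := @measurable_disc2 R.
have iPsi : mu2.-integrable disc2 (EFin \o (fun u => Psi (of_pair u))).
  have iFGG := integrableD mD iF (integrableD mD iG iG).
  apply: (le_integrable mD _ _ iFGG).
    by apply/measurable_EFinP; exact: measurable_fun_disc2.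
  move=> u uD; have zD : unit_disc (of_pair u) := uD.
  rewrite /= lee_fin; move: (of_pair u) zD => z zD.
  have F0 : 0 <= modulus (F z) `^ p by exact: powR_ge0.
  have G0 : 0 <= modulus (G z) `^ p by exact: powR_ge0.
  rewrite [leRHS]ger0_norm ?addr_ge0 //.
  apply: le_trans (ge_Re _) _.
  have -> : conj f.[z] * K z = conj f.[z] * (q z * F z) - conj f.[z] * f.[z].
    by rewrite /K {4}fq //; ring.
  have [h _] := YM z zD.
  have hp : p^-1 * modulus (F z) `^ p <= modulus (F z) `^ p by rewrite ler_piMl // ltW.
  have hp' : 0 <= p^-1 * modulus (G z) `^ p by rewrite mulr_ge0 // ltW.
  apply: le_trans (modulusB _ _) _.
  rewrite conj_mul modulus_real ger0_norm ?sqr_ge0 // -Gf //; lra.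
have Psi0 : (\int[mu2]_(u in disc2) (Psi (of_pair u))%:E = 0)%E.
  apply: (integral_circle_mean0 cPsi iPsi) => z zD.
  exact: (circle_mean_conj_poly sf zD dK lK).
have iB := integrableB mD iF iG.
have int0 : (\int[mu2]_(u in disc2) (Phi (of_pair u))%:E = 0)%E.
  apply/eqP; rewrite eq_le; apply/andP; split; last first.
    by apply: integral_ge0 => u uD; rewrite lee_fin; exact: Phi_ge0.
  have iA : mu2.-integrable disc2 (EFin \o (fun u => p^-1 * (hF (of_pair u) - hG (of_pair u)))).
    have := integrableZl mD p^-1 iB.
    exact.
  rewrite (_ : (\int[mu2]_(u in disc2) (Phi (of_pair u))%:E)%E =
    (\int[mu2]_(u in disc2) (p^-1 * (hF (of_pair u) - hG (of_pair u)))%:E -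
     \int[mu2]_(u in disc2) (Psi (of_pair u))%:E)%E); last first.
    exact: (integralB_EFin mD iA iPsi).
  rewrite Psi0 sube0.
  have -> : (\int[mu2]_(u in disc2) (p^-1 * (hF (of_pair u) - hG (of_pair u)))%:E)%E =
      ((p^-1)%:E * (pth_power_integral p F - pth_power_integral p G))%E.
    rewrite -(integralB_EFin mD iF iG).
    exact: (integralZl mD iB p^-1).
  apply: mule_ge0_le0; first by rewrite lee_fin ltW.
  rewrite sube_le0; exact: FG.
move=> z zD; have [_] := YM z zD; apply; rewrite -PhiE //.
exact: (continuous_eq0_of_integral cPhi Phi_ge0 int0).
Qed.

End extremal.

(** * The main theorem *)

Section main.
Context {R : realType}.
Local Notation C := (Cplx R).
Implicit Types (F G : C -> C) (p : R).

Lemma expR_powR (x p : R) : expR x `^ p = expR (p * x).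
Proof. by rewrite /powR gt_eqF ?expR_gt0 // expRK. Qed.

Lemma modulus_cexpZ (t : R) (w : C) : modulus (cexp (of_real t * w)) = expR (t * complex.Re w).
Proof. by rewrite modulus_cexp; case: w => a b; rewrite /of_real /= mul0r subr0. Qed.

(** [G] has the prescribed jet, so it is admissible and the norm of [F] is at
    most its own. *)
Lemma extremal_eq_competitor p N (c : 'I_N.+1 -> C) F G (f : {poly C}) p1 : 1 < p ->
  bergman p F -> has_jet c F ->
  bergman_norm p F = ereal_inf [set bergman_norm p g | g in [set g | bergman p g /\ has_jet c g]] ->
  (size f <= N.+1)%N -> analytic_on unit_disc G ->
  (forall z, unit_disc z -> modulus (G z) `^ p = modulus f.[z] ^+ 2) ->
  flat N (fun z => G z - (taylor_poly c).[z]) ->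
  bergman_quotient p1 (horner f) G ->
  forall z, unit_disc z -> F z = G z.
Proof.
move=> p1' [dF Ffin] Fjet Fmin sf dG Gf lG [q [[dq _] qE]].
have p0 : 0 < p by exact: lt_trans p1'.
have bG := analytic_deriv_ball dG; have bF := analytic_deriv_ball dF.
have Gjet : has_jet c G by apply/(has_jet_flat _ ltr01 bG).
have lF : flat N (fun z => F z - (taylor_poly c).[z]) by apply/(has_jet_flat _ ltr01 bF).
have Gfin := pth_power_integral_root_fin p0 Gf.
have GAp : bergman p G by split; [exact: dG|exact: (bergman_norm_fin G p0).2].
have le : (bergman_norm p F <= bergman_norm p G)%E.
  by rewrite Fmin; apply: ereal_inf_lbound; exists G.
have fq z : unit_disc z -> f.[z] = q z * G z.
  move=> zD; have [G0|G0] := eqVneq (G z) 0; last by rewrite (qE z zD G0) divfK.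
  rewrite G0 mulr0; apply/eqP; rewrite -modulus_eq0 -sqrf_eq0 -(Gf z zD) G0.
  by rewrite modulus0 powR0 // gt_eqF.
have lFG : flat N (fun z => F z - G z).
  apply: flat_near (flatB lF lG); exists 1; first exact: ltr01.
  by move=> z _; rewrite opprB addrA subrK.
have FG := bergman_norm_le p0 le.
exact: (extremal_unique p1' sf dF dG dq Gf fq lFG ((bergman_norm_fin F p0).1 Ffin) FG).
Qed.

End main.

Theorem theorem4p2 (R : realType) (p : R) (N : nat) (c : 'I_N.+1 -> Cplx R)
    (F : Cplx R -> Cplx R) (a0 : Cplx R)
    (p_gt1 : 1 < p) (c0_neq0 : c ord0 != 0)
    (F_Ap : bergman p F) (F_jet : has_jet c F)
    (F_min : bergman_norm p F =
       ereal_inf [set bergman_norm p g | g in [set g | bergman p g /\ has_jet c g]])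
    (a0_pow : is_cpow (p / 2) (c ord0) a0) :
  let f : {poly Cplx R} := taylor_poly (beta (p / 2) a0 c) in
  ((forall z, unit_disc z -> f.[z] != 0) ->
   let f2p := disc_power (2 / p) (c ord0) (horner f) in
   (exists p1 : R, 1 < p1 /\ bergman_quotient p1 (horner f) f2p) ->
   forall z, unit_disc z -> F z = f2p z)
  /\
  (forall r s : nat, (0 < s)%N -> coprime r s -> 2 / p = r%:R / s%:R ->
   (forall z, unit_disc z -> root f z -> (s %| mup z f)%N) ->
   let f2p := disc_root r s (c ord0) (horner f) in
   (exists p1 : R, 1 < p1 /\ bergman_quotient p1 (horner f) f2p) ->
   forall z, unit_disc z -> F z = f2p z).
Proof.
move=> f; have [w [cw a0E]] := a0_pow.
have p0 : 0 < p by exact: lt_trans p_gt1.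
have p20 : p / 2 != 0 by rewrite gt_eqF // divr_gt0.
(* Near 0 the polynomial [h] of the data is [exp L] and [g = exp ((p / 2) L)]. *)
have [g0 [d [L [d0 dL HL]]]] := local_powerP (p / 2) cw.
rewrite -a0E in g0 HL; set g := local_power _ _ _ in g0 HL.
have dg : deriv_ball g 0 d.
  move=> z zd; have zd' : modulus z < d by rewrite subr0 in zd.
  apply: (@derivable_near_eq _ (fun z => cexp (of_real (p / 2) * L z))); last first.
    by apply: derivable_cexpZ; exact: dL.
  exists (d - modulus z); first by rewrite subr_gt0.
  move=> x xz; have [|_ ->//] := HL x.
  rewrite -(subrK z x); apply: le_lt_trans (modulusD _ _) _.
  by rewrite -ltrBrDr.
have sf : (size f <= N.+1)%N by exact: size_taylor_poly.
have lgf : flat N (fun z => g z - f.[z]) by exact: (taylor_flat N d0 dg).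
have f0 : f.[0] = cexp (of_real (p / 2) * w).
  by rewrite /f taylor_poly_at0 /beta /= -/g g0.
have h0 : (taylor_poly c).[0] = c ord0 := taylor_poly_at0 c.
(* On this radius both the local data and the disc are available. *)
set d' := Num.min d 1.
have d'0 : 0 < d' by rewrite lt_min d0 ltr01.
have d'd z : modulus z < d' -> modulus z < d by rewrite lt_min => /andP[].
have d'1 z : modulus z < d' -> unit_disc z by rewrite lt_min => /andP[].
have ballS (H : Cplx R -> Cplx R) : deriv_ball H 0 d -> deriv_ball H 0 d'.
  by move=> dH z zd; apply: dH; move: zd; rewrite subr0; exact: d'd.
have discS (H : Cplx R -> Cplx R) : analytic_on unit_disc H -> deriv_ball H 0 d'.
  by move=> dH z; rewrite subr0 => /d'1; exact: dH.
split=> [fn0 f2p [p1 [_ fq]]|r s s0 _ rs mult f2p [p1 [_ fq]]].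
- have [] : [set g | g 0 = c ord0 /\ is_cpow_branch unit_disc (2 / p) (horner f) g] f2p.
    apply: getPex; have [M [dM M0 fM]] := poly_disc_log f0 fn0.
    exists (fun z => cexp (of_real (2 / p) * M z)); split.
      rewrite M0 mulrA -of_realM (_ : 2 / p * (p / 2) = 1); last by field; rewrite gt_eqF.
      by rewrite mul1r.
    by exists M; split => // z zD; rewrite fM.
  move=> G0 [M [dM HM]].
  have dG : analytic_on unit_disc f2p.
    apply: (@analytic_eq _ (fun z => cexp (of_real (2 / p) * M z))).
      by move=> z /HM[].
    by move=> z zD; apply: derivable_cexpZ; exact: dM.
  apply: (extremal_eq_competitor p_gt1 F_Ap F_jet F_min sf dG _ _ fq).
    move=> z /HM[<- ->]; rewrite modulus_cexpZ modulus_cexp expR_powR expr2 -expRD.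
    by congr expR; field; rewrite gt_eqF.
  apply: (power_flat (f := horner f) (g := g) (t := p / 2) p20 d'0 (ballS _ dL) (discS _ dM)) => //.
  + move=> z zd; have [h1 h2] := HL z (d'd _ zd); have [h3 h4] := HM z (d'1 _ zd).
    split=> //; rewrite h4; congr (cexp (of_real _ * _)).
    by rewrite invf_div.
  + by rewrite f0 g0.
  + by rewrite G0 h0.
- have rsE : r%:R * (p / 2) = s%:R :> R.
    have sn0 : s%:R != 0 :> R by rewrite pnatr_eq0 -lt0n.
    have r2 : r%:R = 2 / p * s%:R :> R by rewrite rs divfK.
    by rewrite r2; field; rewrite gt_eqF.
  have powE x : cexp (of_real (p / 2) * x) ^+ r = cexp x ^+ s.
    rewrite -!cexpMn; congr cexp; rewrite -[LHS]mulr_natl mulrA.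
    have -> : r%:R = of_real r%:R :> Cplx R by rewrite /of_real rmorph_nat.
    by rewrite -of_realM rsE /of_real rmorph_nat mulr_natl.
  have f00 : f.[0] != 0 by rewrite f0 cexp_neq0.
  have [] : [set g | [/\ g 0 = c ord0, analytic_on unit_disc g &
      forall z, unit_disc z -> g z ^+ s = f.[z] ^+ r]] f2p.
    by apply: getPex; apply: disc_root_exists => //; rewrite f0 powE cw.
  move=> G0 dG HG.
  apply: (extremal_eq_competitor p_gt1 F_Ap F_jet F_min sf dG _ _ fq).
    move=> z zD; have m0 := modulus_ge0 (f2p z); have m0' := modulus_ge0 f.[z].
    have rn0 : r%:R != 0 :> R.
      apply: contraTneq s0 => r0; move: rsE; rewrite r0 mul0r => /esym/eqP.
      by rewrite pnatr_eq0 => /eqP ->.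
    have -> : p = s%:R * (2 / r%:R) by rewrite -rsE; field.
    rewrite powRrM powR_mulrn // -modulusX HG // modulusX -powR_mulrn // -powRrM.
    by rewrite mulrC divfK // (powR_mulrn 2).
  apply: (root_flat (f := horner f) (g := g) (r := r) (s := s) s0 d'0) => //.
  + by move=> z _; exact: derivable_hornerC.
  + exact: ballS.
  + by move=> z _; exact: derivable_hornerC.
  + exact: discS.
  + by move=> z /d'1; exact: HG.
  + by move=> z /d'd/HL[<- ->]; rewrite powE.
  + by rewrite G0 h0.
  + by rewrite h0.
Qed.
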